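(* Let $q = 2^h$ with $h > 1$, let $n$ be a prime, and let $\mathcal{O} = \{\pi_0, \pi_1, \dots, \pi_{q^n+1}\}$ be a pseudo-hyperoval of $\mathbf{PG}(3n-1, q)$. For each $i \in \{0, \dots, q^n+1\}$ let $\Delta_i = \{\langle \pi_i, \pi_j\rangle \cap \mathbf{PG}(2n-1,q) : j \neq i\}$, where $\mathbf{PG}(2n-1,q)$ is a $(2n-1)$-dimensional subspace skew to $\pi_i$. Then $\mathcal{O}$ is regular if and only if at least $q^n - 1$ of the $(n-1)$-spreads $\Delta_0, \Delta_1, \dots, \Delta_{q^n+1}$ are regular.
   Context: A generalized $k$-arc of $\mathbf{PG}(3n-1,q)$ is a set of $k$ subspaces of dimension $n-1$ any three of which span $\mathbf{PG}(3n-1,q)$; for $q$ even, a pseudo-hyperoval is a generalized $(q^n+2)$-arc. Each $\Delta_i$ is an $(n-1)$-spread of $\mathbf{PG}(2n-1,q)$, whose regularity does not depend on the chosen complement. An $(n-1)$-regulus of $\mathbf{PG}(2n-1,q)$ is a set of $q+1$ pairwise disjoint $(n-1)$-dimensional subspaces such that every line meeting three of them meets all of them, and every point of such a transversal lies in one of them; any three pairwise disjoint $(n-1)$-spaces lie in a unique $(n-1)$-regulus. An $(n-1)$-spread is regular if for any three of its elements the $(n-1)$-regulus they determine is contained in the spread. Regular pseudo-hyperoval: in $\mathbf{PG}(3n-1,q^n)$ take planes $\xi_1,\dots,\xi_n$ forming an orbit of $\mathrm{Gal}(\mathbb{F}_{q^n}/\mathbb{F}_q)$ and spanning $\mathbf{PG}(3n-1,q^n)$;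 take a hyperoval $\{x_0^{(1)},\dots,x_{q^n+1}^{(1)}\}$ of $\xi_1$ ($q^n+2$ points, no three collinear), let $x_i^{(1)},\dots,x_i^{(n)}$ be the Galois conjugates of $x_i^{(1)}$ and $\pi_i$ the $(n-1)$-space over $\mathbb{F}_q$ they span; pseudo-hyperovals arising this way (up to projective equivalence) are called regular. *)

(* Defs.v *)
From HB Require Import structures.
From mathcomp Require Export all_boot all_order all_fingroup all_algebra all_field.

Set Implicit Arguments.
Unset Strict Implicit.
Unset Printing Implicit Defensive.

Import GRing.Theory.
Local Open Scope ring_scope.

(* A projective subspace of dimension d is a vector subspace of dimension d + 1;
   in particular points, lines and planes have vector dimension 1, 2 and 3. *)

Section SpreadsAndReguli.

Variables (F : finFieldType) (V : vectType F).
Implicit Types (U A B C D P l : {vspace V}) (S R : seq {vspace V}).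

Definition meets A B : Prop := (A :&: B)%VS <> 0%VS.

Definition is_spread (n : nat) U S : Prop :=
  (forall A, A \in S -> \dim A = n /\ (A <= U)%VS) /\
  (forall P, \dim P = 1%N -> (P <= U)%VS -> exists! A, A \in S /\ (P <= A)%VS).

Definition is_regulus (n : nat) U R : Prop :=
  [/\ uniq R /\ size R = (#|F| + 1)%N,
      forall A, A \in R -> \dim A = n /\ (A <= U)%VS,
      forall A B, A \in R -> B \in R -> A <> B -> (A :&: B)%VS = 0%VS
    & forall l A B C,
        \dim l = 2%N -> (l <= U)%VS ->
        A \in R -> B \in R -> C \in R -> A <> B -> A <> C -> B <> C ->
        meets l A -> meets l B -> meets l C ->
        (forall D, D \in R -> meets l D) /\
        (forall P, \dim P = 1%N -> (P <= l)%VS ->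
           exists D, D \in R /\ (P <= D)%VS)].

Definition is_regular_spread (n : nat) U S : Prop :=
  is_spread n U S /\
  forall A B C, A \in S -> B \in S -> C \in S -> A <> B -> A <> C -> B <> C ->
  forall R, is_regulus n U R -> A \in R -> B \in R -> C \in R ->
  forall D, D \in R -> D \in S.

End SpreadsAndReguli.

Section Arcs.

Variables (F : finFieldType) (n : nat).

Definition is_generalized_arc (k : nat)
    (O : 'I_k -> {vspace 'rV[F]_(3 * n)}) : Prop :=
  [/\ injective O,
      forall i, \dim (O i) = n
    & forall i j l, i <> j -> i <> l -> j <> l ->
        (O i + O j + O l)%VS = fullv].

Definition is_pseudo_hyperoval
    (O : 'I_(#|F| ^ n + 2) -> {vspace 'rV[F]_(3 * n)}) : Prop :=
  is_generalized_arc O.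

Definition Delta (k : nat) (O : 'I_k -> {vspace 'rV[F]_(3 * n)})
    (i : 'I_k) (U : {vspace 'rV[F]_(3 * n)}) : seq {vspace 'rV[F]_(3 * n)} :=
  [seq ((O i + O j) :&: U)%VS | j <- enum 'I_k & j != i].

End Arcs.

Section RegularPseudoHyperovals.

(* L plays the role of the field with #|F| ^ n elements. *)
Variables (F : finFieldType) (L : splittingFieldType F) (n : nat).

(* The image of W under the semilinear map applying s to all coordinates; the
   span of the images of a basis is the whole image. *)
Definition conj_space (m : nat) (s : gal_of {:L}) (W : {vspace 'rV[L]_m}) :
    {vspace 'rV[L]_m} :=
  <<[seq map_mx s v | v <- vbasis W]>>%VS.

Definition conj_span (m : nat) (W : {vspace 'rV[L]_m}) : {vspace 'rV[L]_m} :=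
  (\sum_(s in 'Gal({:L} / 1)%g) conj_space s W)%VS.

Definition collinear (m : nat) (A B C : {vspace 'rV[L]_m}) : Prop :=
  exists l : {vspace 'rV[L]_m},
    [/\ \dim l = 2%N, (A <= l)%VS, (B <= l)%VS & (C <= l)%VS].

Definition is_hyperoval (m k : nat) (xi : {vspace 'rV[L]_m})
    (x : 'I_k -> {vspace 'rV[L]_m}) : Prop :=
  [/\ injective x,
      forall i, \dim (x i) = 1%N /\ (x i <= xi)%VS
    & forall i j l, i <> j -> i <> l -> j <> l ->
        ~ collinear (x i) (x j) (x l)].

(* pi i consists of the vectors over F lying in the L-span of the conjugates of
   the hyperoval point x i. *)
Definition arises_from_hyperoval
    (pi : 'I_(#|F| ^ n + 2) -> {vspace 'rV[F]_(3 * n)}) : Prop :=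
  exists (xi : {vspace 'rV[L]_(3 * n)})
         (x : 'I_(#|F| ^ n + 2) -> {vspace 'rV[L]_(3 * n)}),
    [/\ \dim xi = 3%N,
        conj_span xi = fullv,
        is_hyperoval xi x
      & forall i (v : 'rV[F]_(3 * n)),
          v \in pi i <-> map_mx (in_alg L) v \in conj_span (x i)].

Definition is_regular_pseudo_hyperoval
    (O : 'I_(#|F| ^ n + 2) -> {vspace 'rV[F]_(3 * n)}) : Prop :=
  exists (pi : 'I_(#|F| ^ n + 2) -> {vspace 'rV[F]_(3 * n)})
         (g : 'End('rV[F]_(3 * n))),
    [/\ arises_from_hyperoval pi, lker g = 0%VS
      & forall i, O i = (g @: pi i)%VS].

End RegularPseudoHyperovals.

(* Main.v *)
From HB Require Import structures.
Require Import Defs.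
From mathcomp Require Import cyclic zify ring.

(** Coordinatise PG(3n-1, q) by a frame of three regular elements A, B, C and a
    further element, so that every other element is [{(x, x alpha, x beta)}] with
    matrices alpha, beta. Projecting from an element gives a spread set of matrices;
    closure under reguli makes it, up to a factor, an F-space containing 1 that is
    closed under inversion, hence (Hua's identity) closed under [a b a], and since n is
    prime it is a field [F[a]] of order q^n. So A, B, C yield fields K'', K', K and
    the arc is the graph of a bijection f : K -> K' with [a^-1 f(a)] in K''.

    If K and K' differ they meet in F only, and regularity at the elements on an
    F-line of K (at most three elements are irregular and q > 3) shows that f maps
    lines to lines. Then [f(a + 1) - f(a)] lies in F for a nonscalar a, which puts a
    in K'' or in K', a contradiction. Hence K = K', every element is a K-subspace, and
    an eigenvector of K over the field L of order q^n spans, with its conjugates, the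
    extended space and turns the arc into a hyperoval of a plane over L.

    Conversely, for a regular pseudo-hyperoval the trace over the Galois group
    identifies F^(3n) with L^3 so that all elements are L-lines; an element of a
    regulus through three L-lines of the quotient is again an L-line. *)

Set Implicit Arguments.
Unset Strict Implicit.
Unset Printing Implicit Defensive.

Import GRing.Theory.
Local Open Scope ring_scope.

(** * Subfields of matrix rings *)

Lemma dimv_rV (F : fieldType) m : \dim {:'rV[F]_m} = m.
Proof. by rewrite dimvf dim_matrix mul1r. Qed.

Section MatrixSubfields.

Variables (F : fieldType) (n : nat).
Local Notation M := 'M[F]_n.+1.
Implicit Types (E K S : {vspace M}) (a b u : M).

(** For a subspace this is the spread set condition: distinct elements differ by an invertible
    matrix. *)
Definition unit_space S : Prop := forall a, a \in S -> a != 0 -> a \is a GRing.unit.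

Definition mul_space K : Prop := forall a b, a \in K -> b \in K -> a * b \in K.

Lemma orbit_map_inj S (x : 'rV[F]_n.+1) a b :
  unit_space S -> x != 0 -> a \in S -> b \in S -> x *m a = x *m b -> a = b.
Proof.
move=> uS x0 aS bS /eqP; rewrite -subr_eq0 -mulmxBr => e.
apply/eqP; rewrite -subr_eq0; apply: contraTT e => ab.
have /mulmxK h := uS _ (rpredB aS bS) ab.
by apply: contra_neq x0 => e0; rewrite -[x]h e0 mul0mx.
Qed.

Definition orbit_space S (x : 'rV[F]_n.+1) : {vspace 'rV[F]_n.+1} :=
  (linfun (mulmx x) @: S)%VS.

Lemma orbit_spaceP S x y :
  reflect (exists2 a, a \in S & y = x *m a) (y \in orbit_space S x).
Proof.
by apply: (iffP memv_imgP) => -[a aS ->]; exists a; rewrite ?lfunE.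
Qed.

Lemma dim_orbit_space S x : unit_space S -> x != 0 -> \dim (orbit_space S x) = \dim S.
Proof.
move=> uS x0; apply: limg_dim_eq; apply/eqP; rewrite -subv0; apply/subvP => a.
rewrite memv_cap memv_ker lfunE /= memv0 => /andP[aS /eqP xa].
by apply/eqP/(orbit_map_inj uS x0) => //; rewrite ?mem0v // xa mulmx0.
Qed.

(** Evaluation at one nonzero row vector embeds [S] into the row space. *)
Lemma dim_unit_space S : unit_space S -> (\dim S <= n.+1)%N.
Proof.
move=> uS; have x0 : const_mx 1 != 0 :> 'rV[F]_n.+1.
  by apply/eqP => /rowP/(_ 0)/eqP; rewrite !mxE oner_eq0.
by rewrite -(dim_orbit_space uS x0) -[leqRHS](dimv_rV F) dimvS ?subvf.
Qed.

(** Left multiplication by [a] is injective on the finite-dimensional [E], so it is onto and reaches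
    1. *)
Lemma division_space_inv E a : 1 \in E -> mul_space E -> unit_space E ->
  a \in E -> a^-1 \in E.
Proof.
move=> E1 mE uE aE; have [->|a0] := eqVneq a 0; first by rewrite invr0 mem0v.
have ua := uE _ aE a0.
have ra : (linfun (mulmx a) @: E)%VS = E.
  apply/eqP; rewrite eqEdim limg_dim_eq ?leqnn ?andbT.
    by apply/subvP => c /memv_imgP[d dE ->]; rewrite lfunE /=; apply: mE.
  apply/eqP; rewrite -subv0; apply/subvP => c.
  rewrite memv_cap memv_ker lfunE /= memv0 => /andP[_ /eqP ac].
  by rewrite -[c](mulKmx ua) ac mulmx0.
move: E1; rewrite -{1}ra => /memv_imgP[b bE]; rewrite lfunE /= => e.
by rewrite -[a^-1]mulr1 e mulKr.
Qed.

(* The row vectors form a vector space over the division ring E. *)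
Lemma dim_division_dvdn E :
  1 \in E -> mul_space E -> unit_space E -> (\dim E %| n.+1)%N.
Proof.
move=> E1 mE uE.
have dV := dimv_rV F n.+1.
(* Induction on a bound [k] for the codimension of an [E]-stable [Y]: adjoining the orbit of a
   vector outside [Y] lowers the codimension by exactly [\dim E]. *)
suff H k (Y : {vspace 'rV[F]_n.+1}) : (n.+1 - \dim Y <= k)%N ->
    (forall y a, y \in Y -> a \in E -> y *m a \in Y) -> (\dim E %| n.+1 - \dim Y)%N.
  have := H n.+1 0%VS; rewrite dimv0 subn0; apply=> // y a.
  by rewrite !memv0 => /eqP-> _; rewrite mul0mx.
elim: k Y => [|k IH] Y.
  by rewrite leqn0 => /eqP-> _; rewrite dvdn0.
move=> lek stY; have [/eqP Yf|] := boolP (Y == fullv).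
  by rewrite Yf dV subnn dvdn0.
rewrite eqEsubv subvf /= => /subvPn[w _ wY].
have w0 : w != 0 by apply: contraNneq wY => ->; rewrite mem0v.
have dis : (Y :&: orbit_space E w = 0)%VS.
  apply/eqP; rewrite -subv0; apply/subvP => v; rewrite memv_cap memv0.
  case/andP=> vY /orbit_spaceP[a aE va].
  case: (eqVneq a 0) => [a0|a0]; first by rewrite va a0 mulmx0.
  have ua := uE _ aE a0.
  case/negP: wY; rewrite -[w](mulmxK ua) -va; apply: stY => //.
  exact: division_space_inv.
have dYE : \dim (Y + orbit_space E w) = (\dim Y + \dim E)%N.
  by rewrite dimv_disjoint_sum // dim_orbit_space.
have leY : (\dim Y + \dim E <= n.+1)%N by rewrite -dYE -[leqRHS]dV dimvS ?subvf.
have posE : (0 < \dim E)%N.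
  by rewrite lt0n dimv_eq0; apply/eqP => E0; move: E1; rewrite E0 memv0 oner_eq0.
have -> : (n.+1 - \dim Y = (n.+1 - \dim (Y + orbit_space E w)) + \dim E)%N.
  by rewrite dYE; lia.
rewrite dvdn_addl //; apply: IH; first by rewrite dYE; lia.
move=> y a /memv_addP[y1 y1Y [y2 /orbit_spaceP[b bE ->] ->]] aE.
rewrite mulmxDl memv_add ?stY //; apply/orbit_spaceP; exists (b *m a).
  exact: mE.
by rewrite mulmxA.
Qed.

(** In prime degree such a space is commutative, being spanned by the powers of one element
    ([field_space_generated]). *)
Definition field_space K : Prop :=
  [/\ 1 \in K, mul_space K, unit_space K & \dim K = n.+1].

Lemma field_space_inv K a : field_space K -> a \in K -> a^-1 \in K.
Proof. by case=> ? ? ? _; apply: division_space_inv. Qed.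

Hypothesis n_prime : prime n.+1.

(** The dimension divides a prime, and dimension 1 would leave only scalars. *)
Lemma division_space_dim E a : 1 \in E -> mul_space E -> unit_space E ->
  a \in E -> a \notin <[1]>%VS -> \dim E = n.+1.
Proof.
move=> E1 mE uE aE a1; have := dim_division_dvdn E1 mE uE.
case/primeP: n_prime => _ h /h/orP[/eqP d1|/eqP //].
have : (<[1]> <= E)%VS by rewrite -memvE.
move/dimv_leqif_eq => [_]; rewrite d1 dim_vline oner_eq0 eqxx => /esym/eqP e.
by rewrite e aE in a1.
Qed.

(** The intersection is a division space with a nonscalar element, so it already has full
    dimension. *)
Lemma field_space_eq K K' a : field_space K -> field_space K' ->
  a \in K -> a \in K' -> a \notin <[1]>%VS -> K = K'.
Proof.
move=> [K1 mK uK dK] [K1' mK' uK' dK'] aK aK' a1.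
have dI : \dim (K :&: K') = n.+1.
  apply: (@division_space_dim _ a); rewrite ?memv_cap ?K1 ?K1' ?aK ?aK' //.
  - by move=> x y; rewrite !memv_cap => /andP[? ?] /andP[? ?]; rewrite mK ?mK'.
  - by move=> x; rewrite memv_cap => /andP[xK _]; apply: uK.
have /eqP <- : (K :&: K' == K)%VS by rewrite eqEdim capvSl dI dK leqnn.
by apply/eqP; rewrite eqEdim capvSr dI dK' leqnn.
Qed.

End MatrixSubfields.

(** * Jordan-closed spaces of matrices are fields in prime degree *)

Section JordanClosedSpaces.

Variables (F : finFieldType) (n : nat).
Local Notation M := 'M[F]_n.+1.
Implicit Types (E K S T : {vspace M}) (a b u : M).

(** Scaling moves along the line through 0. The sum a + b is the point of parameter [t0] on the line
    from (1 - t0)^-1 a to t0^-1 b, which is why a scalar other than 0 and 1 is required. *)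
Lemma affine_closed_vspace (S : {set M}) (t0 : F) :
    t0 != 0 -> t0 != 1 -> 0 \in S ->
    (forall t a b, a \in S -> b \in S -> a + t *: (b - a) \in S) ->
  exists T, forall a, (a \in T) = (a \in S).
Proof.
move=> t00 t01 S0 aff.
have sS t a : a \in S -> t *: a \in S.
  by move=> aS; have := aff t 0 a S0 aS; rewrite add0r subr0.
have dS a b : a \in S -> b \in S -> a + b \in S.
  move=> aS bS.
  have := aff t0 _ _ (sS (1 - t0)^-1 a aS) (sS t0^-1 b bS).
  rewrite scalerBr !scalerA divff // scale1r addrCA -scalerBl addrC.
  have -> // : (1 - t0)^-1 - t0 * (1 - t0)^-1 = 1.
    by field; rewrite subr_eq0 eq_sym.
  by rewrite scale1r.
exists <<enum S>>%VS => a; apply/idP/idP => [|aS]; last first.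
  by rewrite memv_span // mem_enum.
move/(@coord_span _ _ _ (in_tuple (enum S))) ->.
apply: (big_ind (fun x => x \in S)) => // i _.
by apply: sS; rewrite -mem_enum mem_nth.
Qed.

(** Closure of the inverses of [T] under addition; the convention 0^-1 = 0 covers the zero
    matrix. *)
Definition inv_add_closed T : Prop :=
  forall a b, a \in T -> b \in T -> (a^-1 + b^-1)^-1 \in T.

Section UnitalSpace.

Variable K : {vspace M}.
Hypotheses (K1 : 1 \in K) (uK : unit_space K) (invK : inv_add_closed K).

(** Apply the closure to 1 and a - 1: (1 + (a - 1)^-1)^-1 = 1 - a^-1. *)
Lemma inv_add_closedV a : a \in K -> a^-1 \in K.
Proof.
move=> aK; have [->|a0] := eqVneq a 0; first by rewrite invr0 mem0v.
have [->|a1] := eqVneq a 1; first by rewrite invr1.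
have ua := uK aK a0.
have ua1 : a - 1 \is a GRing.unit by rewrite uK ?rpredB // subr_eq0.
have := invK K1 (rpredB aK K1); rewrite invr1.
have -> : 1 + (a - 1)^-1 = a * (a - 1)^-1.
  by apply: (mulIr ua1); rewrite mulrDl mulVr // mul1r mulrVK // subrK.
rewrite invrM ?unitrV // invrK mulrBl divrr // mul1r => h.
by have := rpredB K1 h; rewrite opprB addrC subrK.
Qed.

(* Hua's identity a - (a^-1 + (b^-1 - a)^-1)^-1 = a b a. *)
Lemma hua_closed a b : a \in K -> b \in K -> a * b * a \in K.
Proof.
move=> aK bK.
have [->|a0] := eqVneq a 0; first by rewrite mulr0 mem0v.
have [->|b0] := eqVneq b 0; first by rewrite mulr0 mul0r mem0v.
have ua := uK aK a0; have ub := uK bK b0.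
(* The identity degenerates when b^-1 = a, but then a b a = a. *)
have [ab|ab] := eqVneq b^-1 a; first by rewrite -ab mulVr // mul1r ab.
have uba : b^-1 - a \is a GRing.unit.
  by rewrite uK ?rpredB ?inv_add_closedV // subr_eq0.
have := invK aK (rpredB (inv_add_closedV bK) aK).
have -> : a^-1 + (b^-1 - a)^-1 = a^-1 * b^-1 * (b^-1 - a)^-1.
  apply: (mulIr uba); rewrite mulrVK // mulrDl mulVr //.
  by rewrite mulrBr mulVr // subrK.
rewrite invrM ?unitrMl ?unitrV // [(a^-1 * _)^-1]invrM ?unitrV // !invrK mulrA.
rewrite mulrBl mulVr // mulrBl mul1r => h.
by have := rpredB aK h; rewrite opprB addrC subrK.
Qed.

(** Two-step induction from a^(i+2) = a a^i a. *)
Lemma hua_closed_exp a i : a \in K -> a ^+ i \in K.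
Proof.
move=> aK; elim/ltn_ind: i => -[|[|i]] IH; rewrite ?expr0 ?expr1 //.
by rewrite exprS exprSr mulrA hua_closed // IH.
Qed.

Lemma unit_exp_finite a : a \is a GRing.unit -> exists2 N, (0 < N)%N & a ^+ N = 1.
Proof.
move=> ua; pose g := FinRing.unit M ua.
by exists #[g]%g; rewrite ?order_gt0 // -[a]/(val g) -FinRing.val_unitX expg_order.
Qed.

(** When [a ^+ N = 1] this is the algebra F[a], since exponents can be reduced modulo [N]. *)
Definition power_space a N : {vspace M} := <<[seq (a ^+ i)%R | i <- iota 0 N]>>%VS.

Lemma power_space_exp a N i : (0 < N)%N -> a ^+ N = 1 -> a ^+ i \in power_space a N.
Proof.
move=> N0 aN; rewrite (divn_eq i N) exprD mulnC exprM aN expr1n mul1r.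
by apply/memv_span/map_f; rewrite mem_iota ltn_mod.
Qed.

Lemma power_space_ind a N (P : M -> Prop) : P 0 ->
    (forall b c, P b -> P c -> P (b + c)) -> (forall t i, P (t *: a ^+ i)) ->
  forall b, b \in power_space a N -> P b.
Proof.
move=> P0 PD PZ b /(@coord_span _ _ _ (in_tuple _)) ->.
apply: big_ind => // i _.
have iN : (i < N)%N by case: i => i /=; rewrite size_map size_iota.
by rewrite (nth_map 0%N) ?size_iota ?nth_iota.
Qed.

Lemma mul_power_space a N : (0 < N)%N -> a ^+ N = 1 -> mul_space (power_space a N).
Proof.
move=> N0 aN b c bE cE; elim/power_space_ind: bE => [|x y xE yE|t i].
- by rewrite mul0r mem0v.
- by rewrite mulrDl rpredD.
elim/power_space_ind: cE => [|x y xE yE|s j].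
- by rewrite mulr0 mem0v.
- by rewrite mulrDr rpredD.
by rewrite -scalerAl -scalerAr -exprD !rpredZ // power_space_exp.
Qed.

Hypotheses (n_prime : prime n.+1) (dK : \dim K = n.+1).

(** Any nonscalar [a] in [K] works: [K] contains its powers by Hua's identity, hence contains F[a],
    and this division space has full dimension because the degree is prime. *)
Lemma unital_space_generated :
  exists a N, [/\ (0 < N)%N, a ^+ N = 1, a \in K & K = power_space a N].
Proof.
have [a aK a1] : exists2 a, a \in K & a \notin <[1]>%VS.
  apply/subvPn/negP => /dimvS; rewrite dK dim_vline oner_eq0 /=.
  by case: n n_prime => // n'.
have a0 : a != 0 by apply: contraNneq a1 => ->; rewrite mem0v.
have [N N0 aN] := unit_exp_finite (uK aK a0).
exists a, N; split=> //; have sEK : (power_space a N <= K)%VS.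
  by apply/span_subvP => _ /mapP[i _ ->]; apply: hua_closed_exp.
suff dE : \dim (power_space a N) = n.+1.
  by apply/eqP; rewrite eq_sym eqEdim sEK dK dE /=.
apply: (@division_space_dim _ _ n_prime _ a) => //.
- by rewrite -(expr0 a) power_space_exp.
- exact: mul_power_space.
- by move=> b /(subvP sEK); apply: uK.
- by rewrite -[a]expr1 power_space_exp.
Qed.

Lemma unital_field_space : field_space K.
Proof.
split=> //; have [a [N [N0 aN _ ->]]] := unital_space_generated.
exact: mul_power_space.
Qed.

End UnitalSpace.

Lemma field_space_generated K : prime n.+1 -> field_space K ->
  exists a N, [/\ (0 < N)%N, a ^+ N = 1, a \in K & K = power_space a N].
Proof.
move=> np fK; have [K1 mK uK dK] := fK; apply: unital_space_generated => //.
by move=> a b aK bK; rewrite field_space_inv // rpredD // field_space_inv.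
Qed.

(** Since ((u a)^-1 + (u b)^-1)^-1 = u (a^-1 + b^-1)^-1, the translate u^-1 T inherits the closure
    of [T], and it contains 1. *)
Lemma inv_add_closed_field T u : prime n.+1 ->
    unit_space T -> inv_add_closed T -> \dim T = n.+1 -> u \in T -> u != 0 ->
  exists2 K, field_space K & forall a, a \in T -> u^-1 * a \in K.
Proof.
move=> np uT iT dT uuT u0; have uu := uT _ uuT u0.
pose K := (linfun (mulmx u^-1) @: T)%VS.
have KP a : (a \in K) = (u * a \in T).
  apply/memv_imgP/idP => [[b bT ->]|uaT].
    by rewrite lfunE /= (mulVKr uu).
  by exists (u * a) => //; rewrite lfunE /= [RHS](mulKr uu).
exists K; last by move=> a aT; rewrite KP mulVKr.
have unK : unit_space K.
  move=> a; rewrite KP => uaT a0; rewrite -(unitrMr _ uu) uT //.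
  by apply: contra_neq a0 => e; rewrite -[a](mulKr uu) e mulr0.
apply: unital_field_space => //; first by rewrite KP mulr1.
  move=> a b; rewrite !KP => aT bT.
  have [a0|a0] := eqVneq a 0; first by rewrite a0 invr0 add0r invrK.
  have [b0|b0] := eqVneq b 0; first by rewrite b0 invr0 addr0 invrK.
  have ua : a \is a GRing.unit by apply: unK; rewrite ?KP.
  have ub : b \is a GRing.unit by apply: unK; rewrite ?KP.
  have := iT _ _ aT bT; rewrite !invrM // -mulrDl.
  have [->|s0] := eqVneq (a^-1 + b^-1) 0; first by rewrite mul0r !invr0 mulr0.
  rewrite invrM ?unitrV ?invrK //.
  (* Invertibility of a^-1 + b^-1: multiplied by a on the left and b on the right it becomes a + b,
     and u (a + b) is a nonzero element of [T]. *)
  rewrite -(unitrMr _ ua) -(unitrMl _ ub) mulrDr mulrDl divrr // mul1r mulrVK //.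
  rewrite -(unitrMr _ uu) mulrDr uT ?rpredD // addrC -mulrDr.
  apply: contra_neq s0 => e; have {}e : a + b = 0 by rewrite -[_ + _](mulKr uu) e mulr0.
  have -> : b = - a by apply/eqP; rewrite -addr_eq0 addrC e.
  by rewrite invrN subrr.
rewrite limg_dim_eq //; apply/eqP; rewrite -subv0; apply/subvP => c.
rewrite memv_cap memv_ker lfunE /= memv0 => /andP[_ /eqP ac].
by rewrite -[c](mulVKr uu) [_^-1 * _]ac mulr0.
Qed.

End JordanClosedSpaces.

(** * Arcs coordinatised by two fields *)

Section FieldCoincidence.

Variables (F : finFieldType) (n : nat).
Local Notation M := 'M[F]_n.+1.
Hypothesis n_prime : prime n.+1.

(** Abstract form of the coordinatised arc: [f] sends the first coordinate matrix of an element to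
    the second, and [good c] stands for regularity at the element with first coordinate [c]. Then
    [good_ratio] describes the spread set seen from that element, and [good_on_line] says that
    irregular elements are too few to fill an F-line. *)
Variables (K K' K'' : {vspace M}) (f : M -> M) (good : pred M).
Hypotheses (fieldK : field_space K) (fieldK' : field_space K')
  (fieldK'' : field_space K'').
Hypotheses (f_in : forall a, a \in K -> f a \in K')
  (f_inj : {in K &, injective f}) (f0 : f 0 = 0) (f1 : f 1 = 1).
Hypothesis f_ratio : forall a, a \in K -> a != 0 -> a^-1 * f a \in K''.
Hypothesis good_ratio : forall c, c \in K -> good c ->
  exists T : {vspace M},
    (forall a, a \in K -> a != c -> (a - c)^-1 * (f a - f c) \in T) /\
    (forall u, u \in T -> u != 0 ->
       exists2 K0, field_space K0 & forall a, a \in T -> u^-1 * a \in K0).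
Hypothesis good_on_line : forall a d, a \in K -> d \in K -> d != 0 ->
  exists t : F, good (a + t *: d).

Let K1 : 1 \in K. Proof. by case: fieldK. Qed.

Let uK a : a \in K -> a != 0 -> a \is a GRing.unit.
Proof. by case: fieldK => _ _ u _; apply: u. Qed.

Let uK' a : a \in K' -> a != 0 -> a \is a GRing.unit.
Proof. by case: fieldK' => _ _ u _; apply: u. Qed.

Let mK' a b : a \in K' -> b \in K' -> a * b \in K'.
Proof. by case: fieldK' => _ m _ _; apply: m. Qed.

Let f_neq a b : a \in K -> b \in K -> a != b -> f a - f b != 0.
Proof. by move=> aK bK; rewrite subr_eq0; apply: contra_neq; apply: f_inj. Qed.

Let f_unit a b : a \in K -> b \in K -> a != b -> f a - f b \is a GRing.unit.
Proof. by move=> aK bK ab; rewrite uK' ?f_neq // rpredB ?f_in. Qed.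

(** The ratio [w] of two increments of [f] from [c] along one F-line lies in [K'] and also in the
    field [K0] attached to the good point [c]. A nonscalar [w] would give K0 = K', and this forces K
    = K'. *)
Lemma good_line c b t : K != K' -> c \in K -> good c -> b \in K -> b != c ->
  exists s : F, f (c + t *: (b - c)) = f c + s *: (f b - f c).
Proof.
move=> neqK cK gc bK bc.
have [->|t0] := eqVneq t 0; first by exists 0; rewrite !scale0r !addr0.
have [T [Tin Tfield]] := good_ratio cK gc.
pose e := c + t *: (b - c); rewrite -/e.
have bcK : b - c \in K by rewrite rpredB.
have bc0 : b - c != 0 by rewrite subr_eq0.
have ubc := uK bcK bc0.
have eK : e \in K by rewrite rpredD // rpredZ.
have ec : e != c by rewrite -subr_eq0 /e addrC addKr scaler_eq0 negb_or t0.
have ecE : e - c = t *: (b - c) by rewrite /e addrC addKr.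
pose u := (b - c)^-1 * (f b - f c).
have ufb := f_unit bK cK bc.
have uu : u \is a GRing.unit by rewrite unitrMl ?unitrV.
have u0 : u != 0 by apply: contraTneq uu => ->; rewrite unitr0.
have [K0 fK0 inK0] := Tfield _ (Tin b bK bc) u0.
pose w := (f b - f c)^-1 * (f e - f c).
have uE : u^-1 = (f b - f c)^-1 * (b - c) by rewrite invrM ?unitrV // invrK.
have wK0 : w \in K0.
  have := inK0 _ (Tin e eK ec); rewrite ecE invrZ ?unitfE // -scalerAl -scalerAr.
  rewrite mulrA -/u uE -[_ * (b - c) * _]mulrA mulrV // mulr1.
  by move/(rpredZ t); rewrite scalerA divff // scale1r.
have wK' : w \in K' by rewrite mK' ?field_space_inv ?rpredB ?f_in.
have [/vlineP[r wr]|w1] := boolP (w \in <[1]>%VS).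
  exists r; apply/(addrI (- f c)); rewrite addKr addrC -[LHS](mulVKr ufb) -/w wr.
  by rewrite -scalerAr mulr1.
have KK0 := field_space_eq n_prime fK0 fieldK' wK0 wK' w1.
(* With K0 = K', the normalised slope from [c] to x + c lies in [K']; cancelling the increment of
   [f], also in [K'], leaves u^-1 x^-1. Taking x = 1 frees [u], so every x of [K] is in [K']. *)
have inK' x : x \in K -> x != 0 -> u^-1 * x^-1 \in K'.
  move=> xK x0; have xcK : x + c \in K by rewrite rpredD.
  have xc : x + c != c by rewrite -subr_eq0 addrK.
  have := inK0 _ (Tin _ xcK xc); rewrite KK0 addrK mulrA => h.
  rewrite -[_ * _](mulrK (f_unit xcK cK xc)) mK' // field_space_inv //.
  by rewrite rpredB ?f_in.
have uiK' : u^-1 \in K' by have := inK' _ K1 (oner_neq0 _); rewrite invr1 mulr1.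
have sub : (K <= K')%VS.
  apply/subvP => x xK; have [->|x0] := eqVneq x 0; first by rewrite mem0v.
  rewrite -[x]invrK field_space_inv // -[x^-1](mulVKr uu) mK' ?inK' //.
  by rewrite -[u]invrK field_space_inv.
case/negP: neqK; rewrite eqEdim sub.
by case: fieldK => _ _ _ ->; case: fieldK' => _ _ _ ->; rewrite leqnn.
Qed.

(** The base point [a] may be bad: the line is described from a good point [c] on it and then
    reparametrised. *)
Lemma line_image a d t : K != K' -> a \in K -> d \in K -> d != 0 ->
  exists s : F, f (a + t *: d) = f a + s *: (f (a + d) - f a).
Proof.
move=> neqK aK dK d0; have [r gr] := good_on_line aK dK d0.
pose c := a + r *: d; have cK : c \in K by rewrite rpredD // rpredZ.
have cdK : c + d \in K by rewrite rpredD.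
have cdc : c + d != c by rewrite -subr_eq0 addrC addKr.
have lineE x : exists s : F, f (a + x *: d) = f c + s *: (f (c + d) - f c).
  have [s] := good_line (x - r) neqK cK gr cdK cdc; rewrite [c + d - c]addrC addKr => e.
  by exists s; rewrite -e /c -addrA -scalerDl [r + _]addrC subrK.
have [sa ea] := lineE 0; have [sb eb] := lineE 1; have [se ee] := lineE t.
rewrite scale0r addr0 in ea; rewrite scale1r in eb.
set w := f (c + d) - f c in ea eb ee.
have ab : sb - sa != 0.
  rewrite subr_eq0; apply: contra_neq d0 => sab.
  have : f (a + d) = f a by rewrite ea eb sab.
  by move/f_inj => /(_ (rpredD aK dK) aK)/eqP; rewrite -subr_eq0 addrC addKr => /eqP.
exists ((se - sa) / (sb - sa)).
rewrite ee ea eb opprD addrACA subrr add0r -scalerBl scalerA divfK //.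
by rewrite -addrA -scalerDl [sa + _]addrC subrK.
Qed.

Lemma scalar_to_scalar s : K != K' -> exists r : F, f (s *: 1) = r *: 1.
Proof.
move=> neqK; have [r] := line_image s neqK (mem0v _) K1 (oner_neq0 _).
by rewrite !add0r f0 f1 subr0 add0r; exists r.
Qed.

(** By finiteness [f] permutes the scalars, so a scalar value is already taken at a scalar, and [f]
    is injective. *)
Lemma scalar_image a : K != K' -> a \in K -> f a \in <[1]>%VS -> a \in <[1]>%VS.
Proof.
move=> neqK aK /vlineP[x fa].
have [r rE] := fin_all_exists (fun s => scalar_to_scalar s neqK).
have r_inj : injective r.
  move=> t t' rt; have := rE t; rewrite rt -rE.
  move/f_inj; rewrite !rpredZ // => /(_ isT isT)/eqP.
  by rewrite -subr_eq0 -scalerBl scaler_eq0 oner_eq0 orbF subr_eq0 => /eqP.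
have [r' _ rK'] := injF_bij r_inj.
have : f a = f (r' x *: 1) by rewrite rE rK'.
by move/f_inj => ->; rewrite ?rpredZ // memv_line.
Qed.

(** First f(a + 1) is placed in the F-span of 1 and f(a). If its coefficient at f(a) were not 1, the
    image of the line through a and a + 1 would contain a scalar, against [scalar_image]. *)
Lemma translate_by_scalar (t0 : F) (a : M) : K != K' -> t0 != 0 -> t0 != 1 ->
  a \in K -> a \notin <[1]>%VS -> exists s : F, f (a + 1) = f a + s *: (1 : M).
Proof.
move=> neqK t00 t01 aK a1.
have a0 : a != 0 by apply: contraNneq a1 => ->; rewrite mem0v.
have sK (s : F) : s *: 1 \in K by rewrite rpredZ.
have fFa (s : F) : exists r : F, f (s *: a) = r *: f a.
  have [r] := line_image s neqK (mem0v _) aK a0.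
  by rewrite !add0r f0 subr0 add0r; exists r.
have [alpha [beta e1]] : exists alpha beta : F, f (a + 1) = alpha *: 1 + beta *: f a.
  have t1 : t0 - 1 != 0 by rewrite subr_eq0.
  (* Chosen so that a + 1 lies on the line joining the points t0 and v a, whose images are multiples
     of 1 and f(a). *)
  pose v := t0 / (t0 - 1); have v0 : v != 0 by rewrite mulf_neq0 ?invr_eq0.
  pose d := v *: a - t0 *: 1.
  have dK : d \in K by rewrite rpredB ?rpredZ.
  have d0 : d != 0.
    apply: contraNneq a1 => /eqP; rewrite subr_eq0 => /eqP e.
    by rewrite -[a](scalerK v0) e scalerA rpredZ // memv_line.
  have [s] := line_image v^-1 neqK (sK t0) dK d0.
  have -> : t0 *: 1 + v^-1 *: d = a + 1.
    rewrite /d scalerBr !scalerA mulVf // scale1r addrCA -scalerBl.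
    have -> : t0 - v^-1 * t0 = 1 by rewrite /v; field; rewrite t00 t1.
    by rewrite scale1r.
  have -> : t0 *: 1 + d = v *: a by rewrite addrC subrK.
  have [x ->] := scalar_to_scalar t0 neqK; have [y ->] := fFa v => ->.
  exists (x - s * x), (s * y).
  by rewrite scalerBr !scalerA scalerBl -!addrA [- _ + _]addrC.
have [b1|b1] := eqVneq beta 1; first by exists alpha; rewrite e1 b1 scale1r addrC.
(* The parameter map t -> s t is injective on F, hence onto; the value -(beta - 1)^-1 is the one
   that cancels f(a). *)
have [s sE] := fin_all_exists (fun t => line_image t neqK aK K1 (oner_neq0 _)).
have s_inj : injective s.
  move=> t t' st; have := sE t; rewrite st -sE.
  move/f_inj; rewrite !rpredD // => /(_ isT isT)/addrI/eqP.
  by rewrite -subr_eq0 -scalerBl scaler_eq0 oner_eq0 orbF subr_eq0 => /eqP.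
have [s' _ sK'] := injF_bij s_inj.
have b10 : beta - 1 != 0 by rewrite subr_eq0.
pose t := s' (- (beta - 1)^-1).
have atK : a + t *: 1 \in K by rewrite rpredD.
have at1 : f (a + t *: 1) \in <[1]>%VS.
  rewrite sE sK' e1.
  have -> : alpha *: 1 + beta *: f a - f a = alpha *: 1 + (beta - 1) *: f a.
    by rewrite scalerBl scale1r addrA.
  rewrite scalerDr !scalerA !mulNr mulVf // scaleN1r addrCA subrr addr0.
  by rewrite rpredZ // memv_line.
have := scalar_image neqK atK at1.
by rewrite rpredDr ?(negPf a1) // rpredZ // memv_line.
Qed.

(** If the fields differ, the quotients c = a^-1 f(a) and d = (a + 1)^-1 f(a + 1) in [K''] satisfy a
    (d - c) = s - d for a scalar s and nonscalar a. *)
Lemma coordinate_fields_eq (t0 : F) : t0 != 0 -> t0 != 1 -> K = K'.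
Proof.
move=> t00 t01; apply/eqP/negPn/negP => neqK.
have [a aK a1] : exists2 a, a \in K & a \notin <[1]>%VS.
  apply/subvPn/negP => /dimvS; case: fieldK => _ _ _ ->.
  by rewrite dim_vline oner_eq0 /=; case: n n_prime => // n'.
have [s e] := translate_by_scalar neqK t00 t01 aK a1.
have a0 : a != 0 by apply: contraNneq a1 => ->; rewrite mem0v.
have a10 : a + 1 != 0.
  by apply: contraNneq a1 => /eqP; rewrite addr_eq0 => /eqP->; rewrite rpredN memv_line.
have ua := uK aK a0.
have a1K : a + 1 \in K by rewrite rpredD.
have ua1 := uK a1K a10.
pose c := a^-1 * f a; pose d := (a + 1)^-1 * f (a + 1).
have cK : c \in K'' := f_ratio aK a0.
have dK : d \in K'' := f_ratio a1K a10.
have key : a * (d - c) = s *: 1 - d.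
  have : (a + 1) * d = a * c + s *: 1 by rewrite !mulVKr.
  rewrite mulrDl mul1r mulrBr => h.
  by apply/eqP; rewrite subr_eq addrAC eq_sym subr_eq h addrC.
have [K''1 mK'' uK'' _] := fieldK''.
(* If c = d then both equal s, so f(a) = s a and [a] lies in [K']. *)
have [dc|dc] := eqVneq (d - c) 0.
  move: key; rewrite dc mulr0 => /esym/eqP; rewrite subr_eq0 => /eqP ds.
  have fa : f a = s *: a.
    have /eqP := dc; rewrite subr_eq0 -ds => /eqP cs.
    by rewrite -[f a](mulVKr ua) -/c -cs -scalerAr mulr1.
  have s0 : s != 0.
    have := f_neq aK (mem0v _) a0; rewrite f0 subr0 fa.
    by apply: contra_neq => ->; rewrite scale0r.
  have aK' : a \in K' by rewrite -[a](scalerK s0) -fa rpredZ // f_in.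
  by rewrite (field_space_eq n_prime fieldK fieldK' aK aK' a1) eqxx in neqK.
(* Otherwise a = (s - d) (d - c)^-1 lies in [K''], so K = K''. Then f(a) = a c is a nonscalar
   element of both [K] and [K']. *)
have aK'' : a \in K''.
  rewrite -[a](mulrK (uK'' _ (rpredB dK cK) dc)) key mK'' ?field_space_inv //.
  - by rewrite rpredB // rpredZ.
  - by rewrite rpredB.
have eK := field_space_eq n_prime fieldK fieldK'' aK aK'' a1.
have faK : f a \in K by rewrite -[f a](mulVKr ua) eK mK''.
have faK' := f_in aK.
have fa1 := contra (scalar_image neqK aK) a1.
by rewrite (field_space_eq n_prime fieldK fieldK' faK faK' fa1) eqxx in neqK.
Qed.

End FieldCoincidence.

(** * Row spaces and reguli *)

Section RowSpaces.

Variables (F : fieldType) (m : nat).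

(** Passage from subspaces to matrices: an element of the arc becomes the row space of a matrix that
    is unique up to an invertible left factor. *)
Definition rowv p (a : 'M[F]_(p, m)) : {vspace 'rV[F]_m} :=
  limg (linfun (fun x : 'rV[F]_p => x *m a)).

Lemma rowvP p (a : 'M[F]_(p, m)) v :
  reflect (exists x, v = x *m a) (v \in rowv a).
Proof.
have E x : linfun (fun x : 'rV[F]_p => x *m a) x = x *m a.
  exact: (lfunE (mulmxr a)).
apply: (iffP memv_imgP) => [[x _ ->]|[x ->]]; exists x; rewrite ?E ?memvf //.
Qed.

Lemma mem_rowv p (a : 'M[F]_(p, m)) x : x *m a \in rowv a.
Proof. by apply/rowvP; exists x. Qed.

Lemma rowv_sub p (a : 'M[F]_(p, m)) (U : {vspace 'rV[F]_m}) :
  (forall x, x *m a \in U) -> (rowv a <= U)%VS.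
Proof. by move=> h; apply/subvP => v /rowvP[x ->]. Qed.

Lemma rowv_mul_sub p r (b : 'M[F]_(r, p)) (a : 'M[F]_(p, m)) :
  (rowv (b *m a) <= rowv a)%VS.
Proof. by apply: rowv_sub => x; rewrite mulmxA mem_rowv. Qed.

Lemma rowv_mul_unit p (b : 'M[F]_p) (a : 'M[F]_(p, m)) :
  b \in unitmx -> rowv (b *m a) = rowv a.
Proof.
move=> ub; apply/eqP; rewrite eqEsubv rowv_mul_sub.
by rewrite -{1}[a](mulKmx ub) rowv_mul_sub.
Qed.

Lemma dim_rowv_free p (a : 'M[F]_(p, m)) : row_free a -> \dim (rowv a) = p.
Proof.
move=> fa; rewrite limg_dim_eq ?dimv_rV // capfv; apply/eqP/lker0P => x y.
rewrite !(lfunE (mulmxr a)) /=; exact: row_free_inj.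
Qed.

Lemma rowv_of_dim p (A : {vspace 'rV[F]_m}) :
  \dim A = p -> exists a : 'M[F]_(p, m), rowv a = A.
Proof.
move=> dA; exists (\matrix_(i < p) (vbasis A)`_i); apply/vspaceP => v.
apply/rowvP/idP => [[x ->]|vA].
  rewrite mulmx_sum_row rpred_sum // => i _; rewrite rowK rpredZ //.
  by apply: vbasis_mem; rewrite mem_nth // size_tuple dA.
case: p / dA; exists (\row_i coord (vbasis A) i v).
rewrite mulmx_sum_row [LHS](coord_vbasis vA); apply: eq_bigr => i _.
by rewrite rowK mxE.
Qed.

Lemma rowv_free p (a : 'M[F]_(p, m)) : \dim (rowv a) = p -> row_free a.
Proof.
move=> da; apply: inj_row_free => v va.
have : lker (linfun (fun x : 'rV[F]_p => x *m a)) == 0%VS.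
  rewrite -dimv_eq0; have := limg_ker_dim (linfun (fun x : 'rV[F]_p => x *m a)) fullv.
  by rewrite capfv -/(rowv a) da dimv_rV; lia.
move/lker0P; apply; rewrite !(lfunE (mulmxr a)) /=.
by rewrite va mul0mx.
Qed.

Lemma col3_full p (a b c : 'M[F]_(p, m)) :
  (rowv a + rowv b + rowv c)%VS = fullv -> row_full (col_mx a (col_mx b c)).
Proof.
move=> full; rewrite -sub1mx; apply/row_subP => i.
have : row i 1%:M \in (rowv a + rowv b + rowv c)%VS by rewrite full memvf.
case/memv_addP => _ /memv_addP[_ /rowvP[x ->] [_ /rowvP[y ->] ->]] [_ /rowvP[z ->] ->].
apply/submxP; exists (row_mx x (row_mx y z)).
by rewrite !mul_row_col addrA.
Qed.

End RowSpaces.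

(** * Frames and matrix coordinates *)

Section Frames.

Variables (F : fieldType) (n : nat).
Local Notation N := (3 * n)%N.
Variables (a b c : 'M[F]_(n, N)).
Hypothesis full : (rowv a + rowv b + rowv c)%VS = fullv.

Lemma frame_span p (v : 'M[F]_(p, N)) :
  exists x y z, v = x *m a + y *m b + z *m c.
Proof.
have /submxP[w ->] := submx_full v (col3_full full).
exists (lsubmx w), (lsubmx (rsubmx w)), (rsubmx (rsubmx w)).
by rewrite -{1}[w]hsubmxK -{1}[rsubmx w]hsubmxK !mul_row_col addrA.
Qed.

(** The stacked matrix is square of size 3n, so spanning implies independence. *)
Lemma frame_row_free : row_free (col_mx a (col_mx b c)).
Proof.
have := col3_full full; rewrite /row_full /row_free => /eqP->.
by apply/eqP; lia.
Qed.

Lemma frame_free p (x y z : 'M[F]_(p, n)) :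
  x *m a + y *m b + z *m c = 0 -> [/\ x = 0, y = 0 & z = 0].
Proof.
move=> e; have : row_mx x (row_mx y z) = 0.
  apply: (row_free_inj frame_row_free).
  by rewrite mul0mx !mul_row_col addrA.
rewrite -row_mx0 => /eq_row_mx[-> /eqP]; rewrite -row_mx0 => /eqP/eq_row_mx[-> ->].
by [].
Qed.

Lemma frame_inj p (x y z x' y' z' : 'M[F]_(p, n)) :
  x *m a + y *m b + z *m c = x' *m a + y' *m b + z' *m c ->
  [/\ x = x', y = y' & z = z'].
Proof.
move=> e; have [|/eqP ex /eqP ey /eqP ez] := @frame_free p (x - x') (y - y') (z - z').
  by rewrite !mulmxBl [X in X + _]addrACA [LHS]addrACA -!opprD e subrr.
by move: ex ey ez; rewrite !subr_eq0 => /eqP-> /eqP-> /eqP->.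
Qed.

End Frames.

Lemma nz_vector (F : fieldType) (V : vectType F) (A : {vspace V}) :
  A <> 0%VS -> exists2 v, v \in A & v != 0.
Proof.
by move=> A0; exists (vpick A); rewrite ?memv_pick // vpick0; apply/eqP.
Qed.

Lemma dim1_line (F : fieldType) (V : vectType F) (P : {vspace V}) :
  \dim P = 1%N -> exists2 v, v != 0 & P = <[v]>%VS.
Proof.
move=> dP; have P0 : P <> 0%VS by move=> e; rewrite e dimv0 in dP.
have [v vP v0] := nz_vector P0; exists v => //.
by apply/esym/eqP; rewrite eqEdim -memvE vP dP dim_vline v0.
Qed.

(** * The regulus spanned by two independent row spaces *)

Section Pencil.

Variables (F : finFieldType) (n m : nat) (a b : 'M[F]_(n, m)).
Hypotheses (n_gt0 : (0 < n)%N) (ab_free : row_free (col_mx a b)).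

(** Here (s : t) is a point of the projective line over F; proportional pairs give the same space,
    and [pencil_seq] lists normalised representatives. *)
Definition pencil (s t : F) : {vspace 'rV[F]_m} := rowv (s *: a + t *: b).

Definition pencil_seq : seq {vspace 'rV[F]_m} :=
  rowv b :: [seq rowv (a + t *: b) | t <- enum F].

Lemma pencil_free p (x y : 'M[F]_(p, n)) :
  x *m a + y *m b = 0 -> x = 0 /\ y = 0.
Proof.
move=> e; have : row_mx x y = 0.
  by apply: (row_free_inj ab_free); rewrite mul0mx mul_row_col.
by rewrite -row_mx0 => /eq_row_mx.
Qed.

Lemma pencil_inj p (x y x' y' : 'M[F]_(p, n)) :
  x *m a + y *m b = x' *m a + y' *m b -> x = x' /\ y = y'.
Proof.
move=> e; have [|/eqP ex /eqP ey] := @pencil_free p (x - x') (y - y').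
  by rewrite !mulmxBl addrACA -opprD e subrr.
by move: ex ey; rewrite !subr_eq0 => /eqP-> /eqP->.
Qed.

Lemma pencil_mul (x : 'rV[F]_n) s t :
  x *m (s *: a + t *: b) = (s *: x) *m a + (t *: x) *m b.
Proof. by rewrite mulmxDr -!scalemxAr !scalemxAl. Qed.

Lemma dim_pencil (s t : F) : (s != 0) || (t != 0) -> \dim (pencil s t) = n.
Proof.
move=> st; apply: dim_rowv_free; apply: inj_row_free => x; rewrite pencil_mul.
case/pencil_free => /eqP + /eqP; rewrite !scaler_eq0.
by case/orP: st => /negPf-> /=; [move=> /eqP-> | move=> _ /eqP->].
Qed.

Lemma pencil_cap (s t s' t' : F) :
  s * t' - t * s' != 0 -> (pencil s t :&: pencil s' t')%VS = 0%VS.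
Proof.
move=> det; apply/eqP; rewrite -subv0; apply/subvP => v; rewrite memv_cap memv0.
case/andP=> /rowvP[x ->] /rowvP[y]; rewrite !pencil_mul.
case/pencil_inj => es et; suff -> : x = 0 by rewrite !scaler0 !mul0mx addr0.
apply/eqP; have : (s * t' - t * s') *: x == 0.
  rewrite scalerBl [s * _]mulrC [t * _]mulrC -!scalerA es et !scalerA.
  by rewrite mulrC subrr.
by rewrite scaler_eq0 (negPf det).
Qed.

Lemma pencil_scale k s t : k != 0 -> pencil (k * s) (k * t) = pencil s t.
Proof.
move=> k0; rewrite /pencil -!scalerA -scalerDr -mul_scalar_mx rowv_mul_unit //.
by rewrite unitmxE det_scalar unitfE expf_neq0.
Qed.

Lemma pencil_eq (s t s' t' : F) : (s != 0) || (t != 0) -> (s' != 0) || (t' != 0) ->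
  s * t' - t * s' = 0 -> pencil s t = pencil s' t'.
Proof.
move=> st st' /eqP; rewrite subr_eq0 => /eqP e.
have [s0|s0] := eqVneq s 0.
  rewrite s0 eqxx /= in st; move: e; rewrite s0 mul0r => /esym/eqP.
  rewrite mulf_eq0 (negPf st) /= => /eqP s'0; rewrite s'0 eqxx /= in st'.
  rewrite -(pencil_scale 0 t (mulf_neq0 st' (invr_neq0 st))) mulr0.
  by rewrite s'0 mulfVK.
have s'0 : s' != 0.
  apply: contraTneq st' => s'0; move: e; rewrite s'0 mulr0 => /eqP.
  by rewrite mulf_eq0 (negPf s0) /= => /eqP->; rewrite eqxx.
rewrite -(pencil_scale s t (mulf_neq0 s'0 (invr_neq0 s0))) mulfVK //.
have -> // : s' / s * t = t'.
by apply: (mulfI s0); rewrite e; field.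
Qed.

Lemma pencil_seqP X : X \in pencil_seq <->
  exists s t : F, ((s != 0) || (t != 0)) /\ X = pencil s t.
Proof.
split=> [|[s [t [st ->]]]].
  rewrite inE => /orP[/eqP->|/mapP[t _ ->]].
    by exists 0, 1; rewrite oner_neq0 orbT /pencil scale0r add0r scale1r.
  by exists 1, t; rewrite oner_neq0 /pencil scale1r.
have [s0|s0] := eqVneq s 0.
  rewrite (@pencil_eq s t 0 1) ?oner_neq0 ?orbT //.
    by rewrite /pencil scale0r add0r scale1r mem_head.
  by rewrite s0; ring.
rewrite (@pencil_eq s t 1 (t / s)) ?oner_neq0 //; last by field.
rewrite inE; apply/orP; right; apply/mapP; exists (t / s); first by rewrite mem_enum.
by rewrite /pencil scale1r.
Qed.

Lemma pencil_det (s t s' t' : F) : (s != 0) || (t != 0) -> (s' != 0) || (t' != 0) ->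
  pencil s t <> pencil s' t' -> s * t' - t * s' != 0.
Proof. by move=> st st' ne; apply/eqP => /(pencil_eq st st'). Qed.

(** Three collinear points in three members have proportional coordinate rows over [a] and [b], so
    one row [x] describes the whole transversal. *)
Lemma pencil_transversal (l X1 X2 X3 : {vspace 'rV[F]_m}) : \dim l = 2%N ->
    X1 \in pencil_seq -> X2 \in pencil_seq -> X3 \in pencil_seq ->
    X1 <> X2 -> X1 <> X3 -> X2 <> X3 -> meets l X1 -> meets l X2 -> meets l X3 ->
  exists2 x : 'rV[F]_n, x != 0 & l = (<[x *m a]> + <[x *m b]>)%VS.
Proof.
move=> dl /pencil_seqP[s1 [t1 [st1 ->]]] /pencil_seqP[s2 [t2 [st2 ->]]].
move=> /pencil_seqP[s3 [t3 [st3 ->]]].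
move=> /(pencil_det st1 st2) d12 /(pencil_det st1 st3) d13 /(pencil_det st2 st3) d23.
move=> /nz_vector[p1 + p10] /nz_vector[p2 + p20] /nz_vector[p3 + p30].
rewrite !memv_cap => /andP[l1 X1p] /andP[l2 X2p] /andP[l3 X3p].
have dis12 := pencil_cap d12; have dis13 := pencil_cap d13.
have lE : l = (<[p1]> + <[p2]>)%VS.
  apply/esym/eqP; rewrite eqEdim subv_add -!memvE l1 l2 dl /=.
  rewrite dimv_disjoint_sum ?dim_vline ?p10 ?p20 //.
  apply/eqP; rewrite -subv0 -dis12; apply: capvS; rewrite -memvE //.
have : p3 \in (<[p1]> + <[p2]>)%VS by rewrite -lE.
case/memv_addP => _ /vlineP[k ->] [_ /vlineP[k' ->] e3].
have k'0 : k' != 0.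
  apply: contra_neq p30 => k'0; apply/eqP; rewrite -memv0 -dis13 memv_cap X3p andbT.
  by rewrite e3 k'0 scale0r addr0 rpredZ.
move: X1p X2p X3p => /rowvP[x1 e1] /rowvP[x2 e2] /rowvP[x3].
rewrite e3 e1 e2 !pencil_mul !scalerDr !scalemxAl addrACA -!mulmxDl.
case/pencil_inj => es et.
(* Eliminate [x3] between the [a]-coordinates and the [b]-coordinates. *)
have x1x2 : (k * (s1 * t3 - t1 * s3)) *: x1 + (k' * (s2 * t3 - t2 * s3)) *: x2 = 0.
  have : t3 *: (s3 *: x3) - s3 *: (t3 *: x3) = 0 by rewrite !scalerA mulrC subrr.
  rewrite -es -et !scalerDr !scalerA opprD addrACA -!scalerBl => <-.
  by congr (_ *: _ + _ *: _); ring.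
have c0 : k' * (s2 * t3 - t2 * s3) != 0 by rewrite mulf_neq0.
pose r := - ((k' * (s2 * t3 - t2 * s3))^-1 * (k * (s1 * t3 - t1 * s3))).
have x2E : x2 = r *: x1.
  apply: (scalerI c0); rewrite /r scaleNr scalerN scalerA mulrA divff // mul1r.
  by apply/eqP; rewrite -addr_eq0 addrC x1x2.
exists x1; first by apply: contra_neq p10 => x0; rewrite e1 x0 mul0mx.
apply/eqP; rewrite eqEdim; apply/andP; split.
  rewrite lE subv_add -!memvE e1 e2 x2E !pencil_mul -!scalemxAl.
  by rewrite !memv_add ?rpredZ ?memv_line.
rewrite dl (leq_trans (dimv_add_leqif _ _).1) // !dim_vline.
by case: (_ != 0); case: (_ != 0).
Qed.

(** A transversal is spanned by x a and x b, and its points s x a + t x b lie in the members with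
    parameters (s : t). *)
Lemma pencil_regulus (U : {vspace 'rV[F]_m}) :
  (rowv a <= U)%VS -> (rowv b <= U)%VS -> is_regulus n U pencil_seq.
Proof.
move=> aU bU; have subU s t : (pencil s t <= U)%VS.
  apply: rowv_sub => x; rewrite pencil_mul rpredD //.
    by apply: (subvP aU); rewrite mem_rowv.
  by apply: (subvP bU); rewrite mem_rowv.
have disj X Y : X \in pencil_seq -> Y \in pencil_seq -> X <> Y -> (X :&: Y)%VS = 0%VS.
  move=> /pencil_seqP[s [t [st ->]]] /pencil_seqP[s' [t' [st' ->]]].
  by move/(pencil_det st st')/pencil_cap.
have dimX X : X \in pencil_seq -> \dim X = n.
  by case/pencil_seqP => s [t [st ->]]; apply: dim_pencil.
have self_cap s t s' t' : (s != 0) || (t != 0) -> s * t' - t * s' != 0 ->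
    pencil s t <> pencil s' t'.
  move=> st /pencil_cap + e; rewrite -e capvv => e0.
  by have := dim_pencil st; rewrite e0 dimv0; case: (n) n_gt0.
split.
- split; last by rewrite /= size_map -cardE addn1.
  rewrite /= map_inj_uniq ?enum_uniq ?andbT.
    apply/mapP => -[t _ e].
    have := @self_cap 0 1 1 t; rewrite /pencil scale0r add0r !scale1r; apply => //.
      by rewrite oner_neq0 orbT.
    by rewrite mul0r mul1r sub0r oppr_eq0 oner_neq0.
  move=> t t' e; apply/eqP/negPn/negP => tt'.
  have := @self_cap 1 t 1 t'; rewrite /pencil !scale1r; apply => //.
    by rewrite oner_neq0.
  by rewrite mul1r mulr1 subr_eq0 eq_sym.
- move=> X XR; split; first exact: dimX.
  by case/pencil_seqP: XR => s [t [_ ->]].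
- exact: disj.
move=> l A B C dl _ AR BR CR AB AC BC mA mB mC.
have [x x0 lE] := pencil_transversal dl AR BR CR AB AC BC mA mB mC.
have inl s t : x *m (s *: a + t *: b) \in l.
  by rewrite lE pencil_mul -!scalemxAl memv_add ?rpredZ ?memv_line.
have nz s t : (s != 0) || (t != 0) -> x *m (s *: a + t *: b) != 0.
  move=> st; apply/eqP; rewrite pencil_mul => /pencil_free[/eqP + /eqP].
  by rewrite !scaler_eq0 (negPf x0) !orbF; case/orP: st => /negPf->.
split=> [D /pencil_seqP[s [t [st ->]]] e|P /dim1_line[v v0 ->]].
  case/eqP: (nz _ _ st); apply/eqP.
  by rewrite -memv0 -e memv_cap inl mem_rowv.
rewrite -memvE lE => /memv_addP[_ /vlineP[s ->] [_ /vlineP[t ->] vE]].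
have st : (s != 0) || (t != 0).
  apply: contra_neqT v0; rewrite negb_or !negbK => /andP[/eqP s0 /eqP t0].
  by rewrite vE s0 t0 !scale0r addr0.
exists (pencil s t); split; first by apply/pencil_seqP; exists s, t.
rewrite -memvE vE; apply/rowvP; exists x.
by rewrite pencil_mul -!scalemxAl.
Qed.

End Pencil.

(** * Spread sets of a generalized arc *)

Lemma rowv_sub_add (F : fieldType) p p' p'' m (d : 'M[F]_(p, m)) (a : 'M[F]_(p', m))
    (b : 'M[F]_(p'', m)) :
  (rowv d <= rowv a + rowv b)%VS -> exists x y, d = x *m a + y *m b.
Proof.
move=> sub; have : (d <= col_mx a b)%MS.
  apply/row_subP => h; have := subvP sub _ (mem_rowv d (delta_mx 0 h)).
  case/memv_addP => _ /rowvP[x ->] [_ /rowvP[y ->] eh].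
  by apply/submxP; exists (row_mx x y); rewrite mul_row_col -eh -rowE.
case/submxP => w ->; exists (lsubmx w), (rsubmx w).
by rewrite -{1}[w]hsubmxK mul_row_col.
Qed.

(** Comparing coefficients at [b] shows that the change of basis modulo [q] is the identity. *)
Lemma frame_mod_inj (F : fieldType) n (q b c : 'M[F]_(n, 3 * n)) (s s' : 'M[F]_n) :
    (rowv q + rowv b + rowv c)%VS = fullv ->
    (rowv q + rowv (b + s *m c) = rowv q + rowv (b + s' *m c))%VS ->
  s = s'.
Proof.
move=> full e.
have [|x [y exy]] := @rowv_sub_add _ _ _ _ _ (b + s *m c) q (b + s' *m c).
  by rewrite -e addvSr.
have [|_ <- ->] := @frame_inj _ _ _ _ _ full _ 0 1%:M s x y (y *m s').
  by rewrite mul0mx add0r mul1mx exy mulmxDr mulmxA addrA.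
by rewrite mul1mx.
Qed.

(** If v x = 0 then v d falls into the span of [b] and [c], which is independent of [d]. *)
Lemma frame_coord_unit (F : fieldType) n (a b c d : 'M[F]_(n, 3 * n)) (x y z : 'M[F]_n) :
    (rowv d + rowv b + rowv c)%VS = fullv -> d = x *m a + y *m b + z *m c ->
  x \in unitmx.
Proof.
move=> full e; rewrite -row_free_unit; apply: inj_row_free => v vx.
have [|-> _ _] // := @frame_free _ _ _ _ _ full _ v (- (v *m y)) (- (v *m z)).
by rewrite {1}e !mulmxDr !mulmxA vx mul0mx add0r !mulNmx addrAC addrK subrr.
Qed.

Lemma addv_rowv_mod (F : fieldType) p m (q a : 'M[F]_(p, m)) (y : 'M[F]_p) :
  (rowv q + rowv (a + y *m q) = rowv q + rowv a)%VS.
Proof.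
have sub (d : 'M[F]_(p, m)) (z : 'M[F]_p) : (rowv q + rowv (d + z *m q) <= rowv q + rowv d)%VS.
  rewrite subv_add addvSl /=; apply: rowv_sub => x.
  by rewrite mulmxDr addrC mulmxA memv_add ?mem_rowv.
apply/eqP; rewrite eqEsubv sub /=.
by have := sub (a + y *m q) (- y); rewrite mulNmx addrK.
Qed.

Lemma capv_complement (F : fieldType) (V : vectType F) (Q A U : {vspace V}) :
  (A <= U)%VS -> (U :&: Q = 0)%VS -> ((Q + A) :&: U)%VS = A.
Proof. by move=> AU UQ; rewrite addvC -vspace_modl // capvC UQ addv0. Qed.

Lemma addv_complement (F : fieldType) (V : vectType F) (Q A U : {vspace V}) :
  (Q + U)%VS = fullv -> (Q <= A)%VS -> (Q + (A :&: U))%VS = A.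
Proof. by move=> QU QA; rewrite capvC vspace_modl // QU capfv. Qed.

Section Arc.

Variables (F : finFieldType) (n k : nat).
Local Notation N := n.+1.
Local Notation M := 'M[F]_N.
Variable O : 'I_k -> {vspace 'rV[F]_(3 * N)}.
Hypothesis arcO : is_generalized_arc O.

Lemma arc_dim i : \dim (O i) = N. Proof. by case: arcO. Qed.

Lemma arc_full i j l : j != i -> l != i -> j != l -> (O i + O j + O l)%VS = fullv.
Proof.
by case: arcO => _ _ h; rewrite ![_ == i]eq_sym => /eqP ? /eqP ? /eqP ?; apply: h.
Qed.

Lemma arc_rowv i : exists a : 'M[F]_(N, 3 * N), rowv a = O i.
Proof. exact/rowv_of_dim/arc_dim. Qed.

Lemma arc_not_sub i j l : j != i -> l != i -> j != l -> ~~ (O l <= O i + O j)%VS.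
Proof.
move=> ji li jl; apply/negP => sub; have := (dimv_add_leqif (O i) (O j)).1.
have := arc_full ji li jl; rewrite (addv_idPl sub) => ->.
by rewrite dimv_rV !arc_dim; lia.
Qed.

Lemma arc_add_inj i j l : j != i -> l != i -> (O i + O j = O i + O l)%VS -> j = l.
Proof.
move=> ji li e; apply/eqP/negPn/negP => jl.
by have := arc_not_sub ji li jl; rewrite e addvSr.
Qed.

Section RegularElement.

Variables (i : 'I_k) (U : {vspace 'rV[F]_(3 * N)}).
Hypotheses (dimU : \dim U = (2 * N)%N) (capU : (U :&: O i)%VS = 0%VS).

Lemma arc_add_compl : (O i + U)%VS = fullv.
Proof.
apply/eqP; rewrite eqEdim subvf dimv_rV dimv_disjoint_sum ?arc_dim ?dimU; first by lia.
by rewrite capvC.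
Qed.

Lemma arc_addDelta j : (O i + ((O i + O j) :&: U) = O i + O j)%VS.
Proof. by rewrite addv_complement ?arc_add_compl ?addvSl. Qed.

Lemma mem_Delta j : j != i -> ((O i + O j) :&: U)%VS \in Delta O i U.
Proof. by move=> ji; apply/mapP; exists j => //; rewrite mem_filter ji mem_enum. Qed.

Lemma DeltaP A : A \in Delta O i U ->
  exists2 j, j != i & A = ((O i + O j) :&: U)%VS.
Proof. by case/mapP => j; rewrite mem_filter => /andP[ji _] ->; exists j. Qed.

Hypothesis regular : is_regular_spread N U (Delta O i U).

(** Regularity restated modulo [O i], without the complement [U]: when [a], [b] and [a + b]
    represent arc elements, so does every [a + t *: b]. *)
Lemma regular_pencil j l r (a b : 'M[F]_(N, 3 * N)) t :
    j != i -> l != i -> r != i -> j != l -> j != r -> l != r ->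
    (O i + O j = O i + rowv a)%VS -> (O i + O l = O i + rowv b)%VS ->
    (O i + O r = O i + rowv (a + b))%VS ->
  exists2 r', r' != i & (O i + O r' = O i + rowv (a + t *: b))%VS.
Proof.
move=> ji li ri jl jr lr ea eb eab; have [q qE] := arc_rowv i.
have [u uE] := rowv_of_dim dimU.
have full : (rowv u + rowv q)%VS = fullv by rewrite uE qE addvC arc_add_compl.
(* A representative can be moved into [U] by adding a multiple of [q], whose row space is [O i]. *)
have proj (d : 'M[F]_(N, 3 * N)) : exists y : M, (rowv (d + y *m q) <= U)%VS.
  have [|x [y ->]] := @rowv_sub_add _ _ _ _ _ d u q; first by rewrite full subvf.
  by exists (- y); rewrite mulNmx addrK -uE rowv_mul_sub.
have [y aU] := proj a; have [z bU] := proj b.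
set a' := a + y *m q in aU; set b' := b + z *m q in bU.
have lin s : a + s *: b + (y + s *: z) *m q = a' + s *: b'.
  by rewrite /a' /b' mulmxDl scalerDr scalemxAl addrACA.
have sabU s : (rowv (a' + s *: b') <= U)%VS.
  apply: rowv_sub => x; rewrite mulmxDr -scalemxAr rpredD ?rpredZ //.
    by apply: (subvP aU); rewrite mem_rowv.
  by apply: (subvP bU); rewrite mem_rowv.
have modq s : (O i + rowv (a' + s *: b') = O i + rowv (a + s *: b))%VS.
  by rewrite -lin -qE addv_rowv_mod.
have Dj : ((O i + O j) :&: U)%VS = rowv a'.
  by rewrite ea -qE -(addv_rowv_mod q a y) qE capv_complement.
have Dl : ((O i + O l) :&: U)%VS = rowv b'.
  by rewrite eb -qE -(addv_rowv_mod q b z) qE capv_complement.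
have Dr : ((O i + O r) :&: U)%VS = rowv (a' + b').
  have := sabU 1; have := modq 1; rewrite !scale1r => e sU.
  by rewrite eab -e capv_complement.
have ne j1 j2 : j1 != i -> j2 != i -> j1 != j2 ->
    ((O i + O j1) :&: U)%VS <> ((O i + O j2) :&: U)%VS.
  move=> j1i j2i j12 e; case/eqP: j12; apply: (arc_add_inj j1i j2i).
  by rewrite -(arc_addDelta j1) e arc_addDelta.
have full3 : (rowv q + rowv a' + rowv b')%VS = fullv.
  apply/eqP; rewrite eqEsubv subvf -(arc_full ji li jl).
  rewrite !subv_add -{1}qE -addvA addvSl /=; apply/andP; split.
    by rewrite (subv_trans (addvSr (O i) _)) // ea -qE -(addv_rowv_mod q a y) addvA addvSl.
  rewrite (subv_trans (addvSr (O i) _)) // eb -qE -(addv_rowv_mod q b z).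
  by rewrite subv_add addvSl addvA addvSr.
have ab_free : row_free (col_mx a' b').
  apply: inj_row_free => x; rewrite -[x]hsubmxK mul_row_col => e.
  have [|_ -> ->] := frame_free full3 (x := 0) (y := lsubmx x) (z := rsubmx x).
    by rewrite mul0mx add0r.
  by rewrite row_mx0.
have R := pencil_regulus (ltn0Sn n) ab_free aU bU.
have inR s : rowv (a' + s *: b') \in pencil_seq a' b'.
  rewrite inE; apply/orP; right; apply/mapP; exists s => //.
  by rewrite mem_enum.
have aR : rowv a' \in pencil_seq a' b' by have := inR 0; rewrite scale0r addr0.
have abR : rowv (a' + b') \in pencil_seq a' b' by have := inR 1; rewrite scale1r.
have bR : rowv b' \in pencil_seq a' b' by rewrite mem_head.
rewrite -Dj in aR; rewrite -Dl in bR; rewrite -Dr in abR.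
have := regular.2 _ _ _ (mem_Delta ji) (mem_Delta li) (mem_Delta ri) (ne _ _ ji li jl)
  (ne _ _ ji ri jr) (ne _ _ li ri lr) _ R aR bR abR _ (inR t).
case/DeltaP => r' r'i e; exists r' => //.
by rewrite -modq e arc_addDelta.
Qed.

Section SpreadSet.

Variables (j l : 'I_k) (b c : 'M[F]_(N, 3 * N)).
Hypotheses (ji : j != i) (li : l != i) (jl : j != l).
Hypotheses (bE : rowv b = O j) (cE : rowv c = O l).

(** The classical spread set of the spread in the quotient by [O i]: [O j] has matrix 0, and [O l]
    is the element at infinity. *)
Definition spread_set : {set M} :=
  [set s | [exists r, (r != i) && (O i + O r == O i + rowv (b + s *m c))%VS]].

Lemma spread_setP s :
  reflect (exists2 r, r != i & (O i + O r = O i + rowv (b + s *m c))%VS)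
          (s \in spread_set).
Proof.
rewrite inE; apply: (iffP existsP) => [[r /andP[ri /eqP e]]|[r ri e]].
  by exists r.
by exists r; rewrite ri e eqxx.
Qed.

Lemma spread_set0 : 0 \in spread_set.
Proof. by apply/spread_setP; exists j => //; rewrite mul0mx addr0 bE. Qed.

Lemma spread_set_neq s r : r != i ->
  (O i + O r = O i + rowv (b + s *m c))%VS -> r != l.
Proof.
move=> ri e; apply/eqP => rl; rewrite rl in e.
have := arc_not_sub li ji; rewrite eq_sym => /(_ jl)/negP; apply.
rewrite -bE; apply: rowv_sub => x.
have -> : x *m b = x *m (b + s *m c) - (x *m s) *m c.
  by rewrite mulmxDr mulmxA addrK.
rewrite rpredB //; first by rewrite e (subvP (addvSr _ _)) // mem_rowv.
by rewrite (subvP (addvSr _ _)) // -cE mem_rowv.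
Qed.

(** Two different elements together with [O i] span the whole space, so a vector killed by s' - s
    vanishes. *)
Lemma spread_set_unit s s' : s \in spread_set -> s' \in spread_set ->
  s != s' -> s' - s \is a GRing.unit.
Proof.
move=> /spread_setP[r ri e] /spread_setP[r' r'i e'] ss'.
have [q qE] := arc_rowv i.
have full : (rowv q + rowv b + rowv c)%VS = fullv by rewrite qE bE cE arc_full.
have rr' : r != r'.
  apply: contra_neq ss' => rr'; rewrite rr' e' in e.
  by apply: (frame_mod_inj full); rewrite qE.
have full' : (rowv q + rowv (b + s *m c) + rowv (b + s' *m c))%VS = fullv.
  apply/eqP; rewrite eqEsubv subvf -(arc_full ri r'i rr') /= qE -e subv_add addvSl /=.
  rewrite (subv_trans (addvSr (O i) _)) // e' subv_add addvSr andbT -addvA.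
  exact: addvSl.
have : row_free (s' - s).
  apply: inj_row_free => x xs; have [|_ _ ->] // :=
    @frame_free _ _ _ _ _ full' _ 0 (- x) x.
  rewrite mul0mx add0r mulNmx addrC -mulmxBr opprD addrACA subrr add0r -mulmxBl mulmxA.
  by rewrite xs mul0mx.
by rewrite row_free_unit.
Qed.

(** As s' - s is invertible, [O l] is also the row space of (s' - s) c. The three elements then have
    the form [a], [b], [a + b] of [regular_pencil]. *)
Lemma spread_set_affine t s s' : s \in spread_set -> s' \in spread_set ->
  s + t *: (s' - s) \in spread_set.
Proof.
move=> sS s'S; have [->|ss'] := eqVneq s s'; first by rewrite subrr scaler0 addr0.
have us := spread_set_unit sS s'S ss'.
have /spread_setP[r ri e] := sS; have /spread_setP[r' r'i e'] := s'S.
have rl := spread_set_neq ri e; have r'l := spread_set_neq r'i e'.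
have abE : b + s *m c + (s' - s) *m c = b + s' *m c.
  by rewrite -addrA -mulmxDl [s + _]addrC subrK.
have rr' : r != r'.
  apply/eqP => rr'; rewrite rr' in e.
  have sub : (O l <= O i + O r')%VS.
    rewrite -cE -(rowv_mul_unit c us); apply: rowv_sub => x.
    have -> : x *m ((s' - s) *m c) = x *m (b + s' *m c) - x *m (b + s *m c).
      by rewrite -mulmxBr -abE [_ - (b + _)]addrC addKr.
    rewrite rpredB //; first by rewrite e' (subvP (addvSr _ _)) ?mem_rowv.
    by rewrite e (subvP (addvSr _ _)) ?mem_rowv.
  by have := arc_not_sub r'i li r'l; rewrite sub.
have el : (O i + O l = O i + rowv ((s' - s) *m c))%VS by rewrite rowv_mul_unit // cE.
have e'' : (O i + O r' = O i + rowv (b + s *m c + (s' - s) *m c))%VS by rewrite abE.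
have lr' : l != r' by rewrite eq_sym.
have [r'' r''i er] := regular_pencil t ri li r'i rl rr' lr' e el e''.
apply/spread_setP; exists r'' => //; rewrite er.
by rewrite [in RHS]mulmxDl addrA scalemxAl.
Qed.

(** The coordinate at [b] is invertible, so it can be normalised to the identity, while the
    coordinate at [q] disappears modulo [O i]. *)
Lemma spread_set_cover r : r != i -> r != l ->
  exists s, (O i + O r = O i + rowv (b + s *m c))%VS.
Proof.
move=> ri rl; have [q qE] := arc_rowv i; have [d dE] := arc_rowv r.
have full : (rowv q + rowv b + rowv c)%VS = fullv by rewrite qE bE cE arc_full.
have [x [y [z e]]] := frame_span full d.
have full' : (rowv q + rowv d + rowv c)%VS = fullv by rewrite qE dE cE arc_full.
have uy : y \in unitmx.
  apply: (@frame_coord_unit _ _ b q c d y x z).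
    by rewrite [(rowv d + _)%VS]addvC.
  by rewrite [_ + x *m q]addrC.
exists (invmx y *m z).
have -> : b + invmx y *m z *m c = invmx y *m (d + (- x) *m q).
  by rewrite e mulNmx addrAC [x *m q + _ - _]addrAC subrr add0r mulmxDr mulKmx // mulmxA.
by rewrite rowv_mul_unit ?unitmx_inv // -qE addv_rowv_mod dE.
Qed.

End SpreadSet.

(** Exchanging 0 and infinity in the frame inverts the matrices: s^-1 (b + s c) = c + s^-1 b. *)
Lemma spread_set_inv (b c : 'M[F]_(N, 3 * N)) s :
  s \is a GRing.unit -> s \in spread_set b c -> s^-1 \in spread_set c b.
Proof.
move=> us /spread_setP[r ri e]; apply/spread_setP; exists r => //; rewrite e.
rewrite -[in RHS](rowv_mul_unit _ us) mulmxDr mulmxA.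
by rewrite [s *m s^-1](divrr us) mul1mx addrC.
Qed.

(** The spread sets of both orders of the frame are F-spaces exchanged by inversion, which gives
    [inv_add_closed]. The dimension follows by counting arc elements. *)
Lemma spread_space j l (b c : 'M[F]_(N, 3 * N)) (t0 : F) :
    t0 != 0 -> t0 != 1 -> k = (#|F| ^ N + 2)%N ->
    j != i -> l != i -> j != l -> rowv b = O j -> rowv c = O l ->
  exists T : {vspace M},
    [/\ forall s, (s \in T) = (s \in spread_set b c),
        unit_space T, inv_add_closed T & \dim T = N].
Proof.
move=> t00 t01 kE ji li jl bE cE.
have lj : l != j by rewrite eq_sym.
have S0 := spread_set0 c ji bE; have S0' := spread_set0 b li cE.
have [T TE] := affine_closed_vspace t00 t01 S0 (spread_set_affine ji li jl bE cE).
have [T' TE'] := affine_closed_vspace t00 t01 S0' (spread_set_affine li ji lj cE bE).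
have uT : unit_space T.
  move=> s; rewrite TE => sS s0; rewrite -[s]subr0.
  by apply: (spread_set_unit ji li jl bE cE) => //; rewrite eq_sym.
have uT' : unit_space T'.
  move=> s; rewrite TE' => sS s0; rewrite -[s]subr0.
  by apply: (spread_set_unit li ji lj cE bE) => //; rewrite eq_sym.
have invT s : s \in T -> s^-1 \in T'.
  move=> sT; have [->|s0] := eqVneq s 0; first by rewrite invr0 mem0v.
  by rewrite TE' spread_set_inv ?uT // -TE.
have invT' s : s \in T' -> s^-1 \in T.
  move=> sT; have [->|s0] := eqVneq s 0; first by rewrite invr0 mem0v.
  by rewrite TE spread_set_inv ?uT' // -TE'.
exists T; split=> //; first by move=> s s' sT s'T; rewrite invT' // rpredD // invT.
apply/eqP; rewrite eqn_leq dim_unit_space //=.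
have q1 : (1 < #|F|)%N by rewrite finRing_gt1.
rewrite -(leq_exp2l _ _ q1) -(card_vspace T).
(* The side conditions stay under the existential so that a total choice function exists; 0 is a
   dummy value at [i] and [l]. *)
have cov r : exists s, r != i -> r != l ->
    (O i + O r = O i + rowv (b + s *m c))%VS.
  have [ri|ri] := eqVneq r i; first by exists 0.
  have [rl|rl] := eqVneq r l; first by exists 0.
  by have [s e] := spread_set_cover ji li jl bE cE ri rl; exists s.
have [g gE] := fin_all_exists cov.
pose A := ~: [set i; l].
have cA : #|A| = (#|F| ^ N)%N.
  by rewrite cardsCs setCK card_ord cards2 eq_sym li kE addnK.
have AP r : r \in A -> r != i /\ r != l.
  by rewrite !inE negb_or => /andP[].
rewrite -cA -(@card_in_imset _ _ g A).
  apply/subset_leq_card/subsetP => _ /imsetP[r /AP[ri rl] ->].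
  by rewrite TE; apply/spread_setP; exists r => //; apply: gE.
move=> r r' /AP[ri rl] /AP[r'i r'l] e; apply: (arc_add_inj ri r'i).
by rewrite gE // e -gE.
Qed.

End RegularElement.
End Arc.

(** The identity coefficient at [a] fixes the change of basis, so the space determines its
    coordinates. *)
Lemma frame_coord_inj (F : fieldType) n (a b c : 'M[F]_(n, 3 * n))
    (y z y' z' : 'M[F]_n) :
    (rowv a + rowv b + rowv c)%VS = fullv ->
    rowv (a + y *m b + z *m c) = rowv (a + y' *m b + z' *m c) ->
  y = y' /\ z = z'.
Proof.
move=> full e; set d := a + y *m b + z *m c in e.
have [|w [w0 dE]] := @rowv_sub_add _ _ _ _ _ d (a + y' *m b + z' *m c) (0 : 'M_(n, _)).
  by rewrite -e addvSl.
rewrite mulmx0 addr0 in dE.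
have [|<- -> ->] := @frame_inj _ _ _ _ _ full _ 1%:M y z w (w *m y') (w *m z').
  by rewrite mul1mx -/d dE !mulmxDr !mulmxA.
by rewrite !mul1mx.
Qed.

Lemma exists_not01 (F : finFieldType) : (2 < #|F|)%N -> exists t : F, t != 0 /\ t != 1.
Proof.
move=> q2; pose Z : {set F} := ~: [set 0; 1].
have /card_gt0P[t] : (0 < #|Z|)%N.
  by rewrite cardsCs setCK cards2 eq_sym oner_neq0 subn_gt0.
by rewrite !inE negb_or => /andP[t0 t1]; exists t.
Qed.

(** With x = q^N and y = #|I|: at most three elements of the arc lie outside [I]. *)
Lemma leq_complement (x y : nat) : (x - 1 <= y -> x + 2 - y <= 3)%N.
Proof. lia. Qed.

(** * Coordinates of the arc in a single field *)

Section ArcOverField.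

Variables (F : finFieldType) (n : nat).
Local Notation N := n.+1.
Local Notation k := (#|F| ^ N + 2)%N.
Local Notation M := 'M[F]_N.
Hypotheses (n_prime : prime N) (q_gt3 : (3 < #|F|)%N).
Variables (O U : 'I_k -> {vspace 'rV[F]_(3 * N)}) (I : {set 'I_k}).
Hypothesis arcO : is_generalized_arc O.
Hypothesis complU : forall i, \dim (U i) = (2 * N)%N /\ (U i :&: O i)%VS = 0%VS.
Hypothesis cardI : (#|F| ^ N - 1 <= #|I|)%N.
Hypothesis regI : forall i, i \in I -> is_regular_spread N (U i) (Delta O i (U i)).

Lemma arc_spread_space i j l (b c : 'M[F]_(N, 3 * N)) : i \in I ->
    j != i -> l != i -> j != l -> rowv b = O j -> rowv c = O l ->
  exists T : {vspace M},
    [/\ forall s, (s \in T) = (s \in spread_set O i b c),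
        unit_space T, inv_add_closed T & \dim T = N].
Proof.
move=> iI ji li jl bE cE; have [t0 [t00 t01]] := exists_not01 (ltnW q_gt3).
have [dU cU] := complU i.
exact: (spread_space arcO dU cU (regI iI) t00 t01 (erefl _) ji li jl bE cE).
Qed.

(** [I] has at least three elements A, B, C. Rescaling their matrices by the invertible coordinates
    of a fourth element D turns D into the unit point of the frame. *)
Lemma arc_frame : exists A B C D (a b c : 'M[F]_(N, 3 * N)),
  [/\ [/\ A \in I, B \in I & C \in I],
      [/\ A != B, B != C & C != A], [/\ D != A, D != B & D != C],
      [/\ rowv a = O A, rowv b = O B & rowv c = O C]
    & rowv (a + b + c) = O D].
Proof.
have big : (3 < #|F| ^ N)%N.
  by apply: (leq_trans q_gt3); rewrite -{1}(expn1 #|F|) leq_exp2l // finRing_gt1.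
have /card_gt2P[A [B [C [[AI BI CI] [AB BC CA]]]]] : (2 < #|I|)%N by lia.
have [D] : exists D, D \in ~: [set A; B; C].
  apply/card_gt0P; rewrite cardsCs setCK card_ord subn_gt0.
  by rewrite (leq_ltn_trans (leq_card_setU _ _)) // cards2 cards1; case: (_ != _); lia.
rewrite !inE !negb_or => /andP[/andP[DA DB] DC].
have [a aE] := arc_rowv arcO A; have [b bE] := arc_rowv arcO B.
have [c cE] := arc_rowv arcO C; have [d dE] := arc_rowv arcO D.
have BA : B != A by rewrite eq_sym.
have CB : C != B by rewrite eq_sym.
have BD : B != D by rewrite eq_sym.
have CD : C != D by rewrite eq_sym.
have AD : A != D by rewrite eq_sym.
have AC : A != C by rewrite eq_sym.
have full : (rowv a + rowv b + rowv c)%VS = fullv by rewrite aE bE cE (arc_full arcO).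
have [x [y [z e]]] := frame_span full d.
have ux : x \in unitmx.
  apply: (@frame_coord_unit _ _ a b c d x y z) => //.
  by rewrite dE bE cE (arc_full arcO).
have uy : y \in unitmx.
  apply: (@frame_coord_unit _ _ b a c d y x z).
    by rewrite dE aE cE (arc_full arcO).
  by rewrite [_ + x *m a]addrC.
have uz : z \in unitmx.
  apply: (@frame_coord_unit _ _ c a b d z x y).
    by rewrite dE aE bE (arc_full arcO).
  by rewrite -addrA addrC.
exists A, B, C, D, (x *m a), (y *m b), (z *m c).
by rewrite -e !rowv_mul_unit.
Qed.

Lemma arc_over_field : exists (a b c : 'M[F]_(N, 3 * N)) (K : {vspace M}),
  [/\ (rowv a + rowv b + rowv c)%VS = fullv, field_space K
    & forall i, exists x y z, [/\ x \in K, y \in K, z \in K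
        & O i = rowv (x *m a + y *m b + z *m c)]].
Proof.
have [A [B [C [D [a [b [c [[AI BI CI] [AB BC CA] [DA DB DC] [aE bE cE] dE]]]]]]]] := arc_frame.
have BA : B != A by rewrite eq_sym.
have CB : C != B by rewrite eq_sym.
have AC : A != C by rewrite eq_sym.
have full : (rowv a + rowv b + rowv c)%VS = fullv by rewrite aE bE cE (arc_full arcO).
(* Off B and C the coordinate at [a] is invertible and is normalised to the identity. *)
pose J r := (r != B) && (r != C).
have coord r : exists w : M * M, J r -> O r = rowv (a + w.1 *m b + w.2 *m c).
  have [/andP[rB rC]|_] := boolP (J r); last by exists 0.
  have [d eE] := arc_rowv arcO r; have [x [y [z e]]] := frame_span full d.
  have ux : x \in unitmx.
    apply: (@frame_coord_unit _ _ a b c d x y z) => //.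
    by rewrite eE bE cE (arc_full arcO) // eq_sym.
  exists (invmx x *m y, invmx x *m z) => _ /=.
  rewrite -(rowv_mul_unit _ ux) -eE e !mulmxDr !mulmxA mulmxV //.
  by rewrite !mul1mx.
have [w wE] := fin_all_exists coord.
pose al r := (w r).1; pose be r := (w r).2.
have {}wE r : J r -> O r = rowv (a + al r *m b + be r *m c) by move/wE.
have JA : J A by rewrite /J AB AC.
have JD : J D by rewrite /J DB DC.
have [alA beA] : al A = 0 /\ be A = 0.
  by apply: (frame_coord_inj full); rewrite -wE // !mul0mx !addr0 aE.
have [alD beD] : al D = 1%:M /\ be D = 1%:M.
  by apply: (frame_coord_inj full); rewrite -wE // !mul1mx dE.
(* Projecting from C, B and A gives the spaces containing [al], [be] and the quotients al^-1 be
   respectively. *)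
have [K [KE uK iK dK]] := arc_spread_space CI AC BC AB aE bE.
have [K' [KE' uK' iK' dK']] := arc_spread_space BI AB CB AC aE cE.
have [K'' [KE'' uK'' iK'' dK'']] := arc_spread_space AI BA CA BC bE cE.
have eqC r : J r -> (O C + O r = O C + rowv (a + al r *m b))%VS.
  by move=> Jr; rewrite -cE wE // addv_rowv_mod.
have eqB r : J r -> (O B + O r = O B + rowv (a + be r *m c))%VS.
  by move=> Jr; rewrite -bE wE // addrAC addv_rowv_mod.
have alK r : J r -> al r \in K.
  by move=> Jr; rewrite KE; apply/spread_setP; exists r; rewrite ?eqC //; case/andP: Jr.
have beK r : J r -> be r \in K'.
  by move=> Jr; rewrite KE'; apply/spread_setP; exists r; rewrite ?eqB //; case/andP: Jr.
have al_inj r r' : J r -> J r' -> al r = al r' -> r = r'.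
  move=> Jr Jr' e; have [/andP[_ rC] /andP[_ r'C]] := (Jr, Jr').
  by apply: (arc_add_inj arcO rC r'C); rewrite !eqC // e.
have be_inj r r' : J r -> J r' -> be r = be r' -> r = r'.
  move=> Jr Jr' e; have [/andP[rB _] /andP[r'B _]] := (Jr, Jr').
  by apply: (arc_add_inj arcO rB r'B); rewrite !eqB // e.
have fullC : (rowv c + rowv a + rowv b)%VS = fullv by rewrite -addvA addvC.
have al_surj s : s \in K -> exists2 r, J r & al r = s.
  rewrite KE => /spread_setP[r rC e].
  have rB := spread_set_neq arcO AC BC AB aE bE rC e.
  have Jr : J r by rewrite /J rB rC.
  exists r => //; apply: (frame_mod_inj fullC); rewrite cE -eqC //.
(* [al] is a bijection from the indices satisfying [J] onto [K], so [be] becomes a function of [al];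
   0 is a dummy value outside [K]. *)
pose f s := if [pick r | J r && (al r == s)] is Some r then be r else 0.
have fE r : J r -> f (al r) = be r.
  move=> Jr; rewrite /f; case: pickP => [r' /andP[Jr' /eqP e]|/(_ r)].
    by rewrite (al_inj _ _ Jr' Jr e).
  by rewrite Jr eqxx.
have K1 : 1 \in K by rewrite -[1]alD alK.
have K'1 : 1 \in K' by rewrite -[1]beD beK.
have fieldK : field_space K by apply: unital_field_space.
have fieldK' : field_space K' by apply: unital_field_space.
(* Modulo [O r] the coordinate at [a] can be subtracted away; dividing by al r' - al r leaves the
   slope as spread set matrix. *)
have ratio r r' : J r -> J r' -> r' != r ->
    (al r' - al r)^-1 * (be r' - be r) \in spread_set O r b c.
  move=> Jr Jr' rr'; apply/spread_setP; exists r' => //.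
  have ud : al r' - al r \in unitmx.
    by apply: uK; rewrite ?rpredB ?alK // subr_eq0; apply: contra_neq rr'; apply: al_inj.
  rewrite -[in RHS](rowv_mul_unit _ ud) mulmxDr [_ *m (_ *m c)]mulmxA.
  rewrite [_ *m (_ * _)](mulVKr ud).
  rewrite !wE // -(addv_rowv_mod _ (a + al r' *m b + be r' *m c) (- 1%:M)).
  congr (_ + rowv _)%VS; rewrite mulNmx mul1mx !mulmxBl.
  rewrite !opprD addrACA; congr (_ + _).
  by rewrite addrACA subrr add0r.
have K''1 : 1 \in K''.
  have := ratio A D JA JD DA; rewrite -KE'' alA alD beA beD !subr0.
  by rewrite invr1 mulr1.
have fieldK'' : field_space K'' by apply: unital_field_space.
pose good s := [exists r, [&& r \in I, J r & al r == s]].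
have [t0 [t00 t01]] := exists_not01 (ltnW q_gt3).
have KK' : K = K'.
  apply: (@coordinate_fields_eq _ _ n_prime K K' K'' f good _ _ _ _ _ _ _ _ _ _ t0) => //.
  - by move=> s /al_surj[r Jr <-]; rewrite fE // beK.
  - move=> s s' /al_surj[r Jr <-] /al_surj[r' Jr' <-]; rewrite !fE //.
    by move/(be_inj _ _ Jr Jr') ->.
  - by rewrite -alA fE // beA.
  - by rewrite -[1]alD fE // beD.
  - move=> s /al_surj[r Jr <-]; rewrite -alA => rA; rewrite fE // KE''.
    have := ratio A r JA Jr; rewrite alA beA !subr0; apply.
    by apply: contra_neq rA => ->.
  - move=> s sK /existsP[r /and3P[rI Jr /eqP rs]].
    have [Br Cr] : B != r /\ C != r by case/andP: Jr; rewrite !(eq_sym r).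
    have [T [TE uT iT dT]] := arc_spread_space rI Br Cr BC bE cE.
    exists T; split; last by move=> u; apply: inv_add_closed_field.
    move=> s' /al_surj[r' Jr' <-]; rewrite -rs => rr'; rewrite !fE // TE ratio //.
    by apply: contra_neq rr' => ->.
  - move=> s d sK dK0 d0.
    have lineJ t : exists r, J r /\ al r = s + t *: d.
      by have [|r Jr e] := al_surj (s + t *: d); [rewrite rpredD ?rpredZ | exists r].
    have [rho rhoE] := fin_all_exists lineJ.
    (* Otherwise the q distinct elements on the line would all lie outside [I], where there are at
       most three. *)
    apply/existsP; rewrite -[[exists _, _]]negbK negb_exists; apply/negP => /forallP bad.
    have rho_inj : injective rho.
      move=> t t' e; have := (rhoE t).2; rewrite e (rhoE t').2 => /addrI/eqP.
      by rewrite -subr_eq0 -scalerBl scaler_eq0 (negPf d0) orbF subr_eq0 => /eqP.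
    have sub : (rho @: F \subset ~: I).
      apply/subsetP => _ /imsetP[t _ ->]; rewrite inE; apply: contra (bad t) => rI.
      by apply/existsP; exists (rho t); rewrite rI (rhoE t).1 (rhoE t).2 eqxx.
    have := subset_leq_card sub; rewrite card_imset // cardsCs setCK card_ord leqNgt.
    by rewrite (leq_ltn_trans _ q_gt3) // leq_complement.
exists a, b, c, K; split=> // r.
have [->|rB] := eqVneq r B.
  by exists 0, 1, 0; rewrite !mem0v K1 !mul0mx mul1mx add0r addr0 bE.
have [->|rC] := eqVneq r C.
  by exists 0, 0, 1; rewrite !mem0v K1 !mul0mx mul1mx !add0r cE.
have Jr : J r by rewrite /J rB rC.
by exists 1, (al r), (be r); rewrite K1 alK // KK' beK // mul1mx; split=> //; apply: wE.
Qed.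

End ArcOverField.

(** * Galois conjugates and traces *)

Section Conjugates.

Variables (F : finFieldType) (L : splittingFieldType F).
Local Notation G := 'Gal({:L} / 1)%g.
Local Notation "A ^i" := (map_mx (in_alg L) A) (at level 2, format "A ^i").

Lemma card_galois_full : #|G| = \dim {:L}.
Proof. by rewrite -(galois_dim (finField_galois (sub1v _))) dimv1 divn1. Qed.

Lemma mem_conj_space m (s : gal_of {:L}) (W : {vspace 'rV[L]_m}) v :
  v \in W -> map_mx s v \in conj_space s W.
Proof.
move=> vW; rewrite (coord_vbasis vW) raddf_sum rpred_sum // => i _.
rewrite /= map_mxZ rpredZ // memv_span // map_f //.
by rewrite mem_nth // size_tuple.
Qed.

Lemma conj_space_sub m (s : gal_of {:L}) (W W' : {vspace 'rV[L]_m}) :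
  (W <= W')%VS -> (conj_space s W <= conj_space s W')%VS.
Proof.
move=> /subvP sub; apply/span_subvP => _ /mapP[v vW ->].
by apply/mem_conj_space/sub/vbasis_mem.
Qed.

Lemma dim_conj_space m (s : gal_of {:L}) (W : {vspace 'rV[L]_m}) : (\dim (conj_space s W) <= \dim W)%N.
Proof. by rewrite (leq_trans (dim_span _)) // size_map size_tuple. Qed.

Lemma conj_span_sub m (W W' : {vspace 'rV[L]_m}) :
  (W <= W')%VS -> (conj_span W <= conj_span W')%VS.
Proof.
move=> sub; apply/subv_sumP => s sG.
by apply: (sumv_sup s) => //; apply: conj_space_sub.
Qed.

Lemma dim_conj_span m (W : {vspace 'rV[L]_m}) :
  (\dim (conj_span W) <= \dim {:L} * \dim W)%N.
Proof.
rewrite -card_galois_full -sum_nat_const (leq_trans (dimv_leq_sum _ _ _)) //.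
by apply: leq_sum => s _; apply: dim_conj_space.
Qed.

(** The Galois trace as an element of F itself, read off as its coordinate on the basis 1 of the
    prime subspace. *)
Definition trF (l : L) : F := coord [tuple 1 : L] ord0 (galTrace 1 {:L} l).

Lemma trF_alg l : (trF l)%:A = \sum_(s in G) s l.
Proof.
have : galTrace 1 {:L} l \in <<[tuple 1%R : L]>>%VS.
  by rewrite span_seq1 mem_galTrace ?memvf // finField_galois // sub1v.
by move/coord_span; rewrite big_ord1 => e; rewrite -[RHS]/(galTrace 1 {:L} l) {}e.
Qed.

Lemma trF_linear : scalar trF.
Proof.
move=> k u v; apply: (fmorph_inj (in_alg L)) => /=.
rewrite scalerDl -scalerA !trF_alg scaler_sumr -big_split; apply: eq_bigr => s sG /=.
by rewrite linearP.
Qed.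
HB.instance Definition _ := GRing.isLinear.Build F L F *%R trF trF_linear.

(** Over L this is the sum of the Galois conjugates of l w ([map_trace_row]), so it describes the
    F-rational vectors in the span of the conjugates of [w]. *)
Definition trace_row m (w : 'rV[L]_m) (l : L) : 'rV[F]_m := \row_j trF (l * w 0 j).

Lemma trace_row_linear m (w : 'rV[L]_m) : linear (trace_row w).
Proof.
move=> k u v; apply/rowP => j; rewrite !mxE mulrDl linearD /= -scalerAl.
by rewrite linearZ.
Qed.
HB.instance Definition _ m (w : 'rV[L]_m) :=
  GRing.isLinear.Build F L 'rV[F]_m *:%R (trace_row w) (trace_row_linear w).

Lemma map_trace_row m (w : 'rV[L]_m) l :
  (trace_row w l)^i = \sum_(s in G) map_mx s (l *: w).
Proof.
apply/rowP => j; rewrite !mxE summxE /= trF_alg.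
by apply: eq_bigr => s _; rewrite !mxE.
Qed.

Lemma trace_row_conj_span m (w : 'rV[L]_m) l (W : {vspace 'rV[L]_m}) :
  w \in W -> (trace_row w l)^i \in conj_span W.
Proof.
move=> wW; rewrite map_trace_row; apply: memv_sumr => s _.
by rewrite mem_conj_space // rpredZ.
Qed.

Lemma trace_row_mul m p (w : 'rV[L]_m) l (B : 'M[F]_(m, p)) :
  trace_row w l *m B = trace_row (w *m B^i) l.
Proof.
apply/rowP => j; rewrite !mxE mulr_sumr linear_sum /=; apply: eq_bigr => h _.
by rewrite !mxE /= mulrA mulr_algr linearZ /= mulrC.
Qed.

Lemma trace_row_scale m (w : 'rV[L]_m) l k :
  trace_row (k *: w) l = trace_row w (l * k).
Proof. by apply/rowP => j; rewrite !mxE mulrA. Qed.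

(** Vanishing traces give a linear relation among the automorphisms with coefficients s(w_j); by
    their independence the coefficient of the identity, w_j, is 0. *)
Lemma trace_row_eq0 m (w : 'rV[L]_m) : (forall l, trace_row w l = 0) -> w = 0.
Proof.
move=> h; apply/rowP => j; rewrite mxE; have G1 : (1 : gal_of {:L})%g \in G by apply: group1.
have := @gal_independent F L {:L} (mem G) (fun s => s (w 0 j)) _ 1%g G1.
rewrite gal_id; apply=> l _; have /rowP/(_ j) := h l; rewrite !mxE => e.
have := trF_alg (l * w 0 j); rewrite e scale0r => e0; apply: etrans (esym e0); apply: eq_bigr => s _.
by rewrite rmorphM mulrC.
Qed.

Lemma rational_full m (Y : {vspace 'rV[L]_m}) : (forall v : 'rV[F]_m, v^i \in Y) -> Y = fullv.
Proof.
move=> h; apply/eqP; rewrite eqEsubv subvf; apply/subvP => v _.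
rewrite (row_sum_delta v) rpred_sum // => j _; rewrite rpredZ //.
by have := h (delta_mx 0 j); rewrite map_delta_mx.
Qed.

(** Vectors independent over F stay independent over L, so a further rational vector in [Y] would
    exceed its dimension. *)
Lemma rational_mem m (A : {vspace 'rV[F]_m}) (Y : {vspace 'rV[L]_m}) v :
    (\dim Y <= \dim A)%N -> (forall u, u \in A -> u^i \in Y) -> v^i \in Y -> v \in A.
Proof.
move=> dY AY vY; apply/negPn/negP => vA.
have v0 : v != 0 by apply: contraNneq vA => ->; rewrite mem0v.
have dAv : \dim (A + <[v]>) = (\dim A).+1.
  rewrite dimv_disjoint_sum ?dim_vline ?v0 ?addn1 //.
  apply/eqP; rewrite -subv0; apply/subvP => u; rewrite memv_cap memv0.
  case/andP=> uA /vlineP[k uE]; have [k0|k0] := eqVneq k 0.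
    by rewrite uE k0 scale0r.
  by case/negP: vA; rewrite -[v](scalerK k0) -uE rpredZ.
have [M ME] := rowv_of_dim dAv.
have fM : row_free M by apply: rowv_free; rewrite ME.
have : (rowv M^i <= Y)%VS.
  apply: rowv_sub => x; rewrite mulmx_sum_row rpred_sum // => j _; rewrite rpredZ //.
  rewrite -map_row; have : row j M \in (A + <[v]>)%VS by rewrite -ME rowE mem_rowv.
  case/memv_addP => u uA [_ /vlineP[k ->] ->].
  by rewrite map_mxD map_mxZ rpredD ?AY // rpredZ.
move/dimvS; rewrite dim_rowv_free ?row_free_map // => /leq_trans/(_ dY).
by rewrite ltnn.
Qed.

End Conjugates.

(** * A common eigenvector of the matrix field *)

Section Eigenvector.

Variables (F : finFieldType) (L : splittingFieldType F) (n : nat).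
Local Notation N := n.+1.
Local Notation M := 'M[F]_N.
Local Notation "A ^i" := (map_mx (in_alg L) A) (at level 2, format "A ^i").
Hypotheses (n_prime : prime N) (dimL : \dim {:L} = N).
Variable K : {vspace M}.
Hypothesis fieldK : field_space K.

(** Lagrange's theorem in the group of the q^N - 1 nonzero elements of [K]. *)
Lemma field_space_frobenius a : a \in K -> a ^+ (#|F| ^ N) = a.
Proof.
move=> aK; have [->|a0] := eqVneq a 0.
  by rewrite expr0n expn_eq0 (gtn_eqF (ltnW (finRing_gt1 F))).
have [K1 mK uK dK] := fieldK; have ua := uK _ aK a0.
pose H := [set u : {unit M} | val u \in K].
have gH : group_set H.
  by apply/group_setP; split=> [|u v]; rewrite !inE //= => ? ?; apply: mK.
have cH : #|H| = (#|F| ^ N).-1.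
  have -> : #|H| = #|[set b in K | b != 0]|.
    rewrite -(card_imset _ val_inj); apply: eq_card => b.
    apply/imsetP/idP => [[u uH ->]|].
      rewrite !inE in uH *; rewrite uH /=.
      by apply/eqP => u0; have := valP u; rewrite [X in X \is a _]u0 unitr0.
    rewrite !inE => /andP[bK b0].
    by exists (FinRing.unit M (uK _ bK b0)); rewrite ?inE.
  have := card_vspace K; rewrite dK => <-.
  rewrite (cardD1 0 K) mem0v /=; apply: eq_card => b.
  by rewrite !inE andbC.
have : ((FinRing.unit M ua) ^+ #|H| = 1)%g.
  by apply: (@expg_cardG _ (Group gH)); rewrite !inE.
move/(congr1 val); rewrite FinRing.val_unitX cH /= => e.
by rewrite -[(#|F| ^ N)%N]prednK ?exprS ?e ?mulr1 // expn_gt0 (ltnW (finRing_gt1 F)).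
Qed.

(** L has q^N elements; [finvect_type] views it as a finite field, where the product runs over all
    elements. *)
Lemma frobenius_split : exists r : seq L,
  'X^(#|F| ^ N) - 'X = \prod_(x <- r) ('X - x%:P) :> {poly L}.
Proof.
have e : #|finvect_type L| = (#|F| ^ N)%N.
  by rewrite -dimL -[RHS](card_vspace (fullv : {vspace finvect_type L})) card_vspacef.
have : exists r : seq (finvect_type L),
    'X^(#|F| ^ N) - 'X = \prod_(x <- r) ('X - x%:P) :> {poly finvect_type L}.
  by exists (enum (finvect_type L)); rewrite big_enum -finField_genPoly e.
exact.
Qed.

(** K = F[a] for some [a] annihilated by X^(q^N) - X. As this splits over L, some a - th is
    singular, and a row it kills is an eigenvector of every power of [a]. *)
Lemma field_space_eigenvector : exists2 w : 'rV[L]_N, w != 0 &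
  forall b, b \in K -> exists k, w *m b^i = k *: w.
Proof.
have [a [P [P0 aP aK KE]]] := field_space_generated n_prime fieldK.
have [r rE] := frobenius_split.
have zero : \prod_(x <- r) (a^i - x%:M) = 0 :> 'M[L]_N.
  have := congr1 (horner_mx a^i) rE.
  rewrite rmorphB rmorphXn /= horner_mx_X -rmorphXn field_space_frobenius // subrr.
  rewrite rmorph_prod => ->; apply: eq_bigr => x _.
  by rewrite rmorphB /= horner_mx_X horner_mx_C.
have [th nu] : exists th : L, ~~ (a^i - th%:M \is a GRing.unit).
  have : ~~ all (fun x => a^i - x%:M \is a GRing.unit) r.
    apply/negP => /allP h.
    have : \prod_(x <- r) (a^i - x%:M) \is a @GRing.unit 'M[L]_N.
      rewrite big_seq; elim/big_ind: _ => [|x y ux uy|x xr]; rewrite ?unitr1 //.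
        by rewrite unitrMl.
      exact: h.
    by rewrite zero unitr0.
  by case/allPn => x _ nx; exists x.
have : kermx (a^i - th%:M) != 0 by rewrite kermx_eq0 row_free_unit.
case/rowV0Pn => w /sub_kermxP; rewrite mulmxBr mul_mx_scalar => /eqP.
rewrite subr_eq0 => /eqP wa w0; exists w => // b; rewrite KE.
have wX i : w *m (a ^+ i)^i = th ^+ i *: w.
  elim: i => [|i IH]; first by rewrite !expr0 map_mx1 mulmx1 scale1r.
  by rewrite exprSr map_mxM mulmxA IH -scalemxAl wa scalerA -exprSr.
elim/power_space_ind => [|x y [k xE] [k' yE]|t i].
- by exists 0; rewrite map_mx0 mulmx0 scale0r.
- by exists (k + k'); rewrite map_mxD mulmxDr xE yE scalerDl.
- by exists (t%:A * th ^+ i); rewrite map_mxZ -scalemxAr wX scalerA.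
Qed.

(** The image is a nonzero space stable under [K], because multiplying by b replaces l by l k for
    the eigenvalue k; the [K]-orbit of one nonzero vector is already everything. *)
Lemma trace_row_surj (w : 'rV[L]_N) : w != 0 ->
    (forall b, b \in K -> exists k, w *m b^i = k *: w) ->
  forall x : 'rV[F]_N, exists l, x = trace_row w l.
Proof.
move=> w0 eig x; pose Y := limg (linfun (trace_row w)).
suff : x \in Y by case/memv_imgP => l _ ->; exists l; rewrite lfunE.
have [K1 mK uK dK] := fieldK.
have Y0 : Y <> 0%VS.
  move=> Y0; case/eqP: w0; apply: (@trace_row_eq0 F L) => l; apply/eqP.
  by rewrite -memv0 -Y0; apply/memv_imgP; exists l; rewrite ?memvf ?lfunE.
have [y yY y0] := nz_vector Y0.
have sub : (orbit_space K y <= Y)%VS.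
  apply/subvP => _ /orbit_spaceP[b bK ->].
  case/memv_imgP: yY => l _ ->; have [k e] := eig b bK.
  apply/memv_imgP; exists (l * k); rewrite ?memvf // !lfunE /=.
  by rewrite trace_row_mul e trace_row_scale.
apply: (subvP sub); suff -> : orbit_space K y = fullv by rewrite memvf.
by apply/eqP; rewrite eqEdim subvf dim_orbit_space // dK dimv_rV /=.
Qed.

End Eigenvector.

(** * The hyperoval over the extension field *)

Section HyperovalOverField.

Variables (F : finFieldType) (L : splittingFieldType F) (n : nat).
Local Notation N := n.+1.
Local Notation M := 'M[F]_N.
Local Notation k := (#|F| ^ N + 2)%N.
Local Notation "A ^i" := (map_mx (in_alg L) A) (at level 2, format "A ^i").
Hypotheses (n_prime : prime N) (dimL : \dim {:L} = N).
Variables (O : 'I_k -> {vspace 'rV[F]_(3 * N)}) (K : {vspace M}).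
Variables (a b c : 'M[F]_(N, 3 * N)).
Hypotheses (arcO : is_generalized_arc O) (fieldK : field_space K).
Hypothesis full : (rowv a + rowv b + rowv c)%VS = fullv.
Hypothesis coordO : forall i, exists x y z, [/\ x \in K, y \in K, z \in K
  & O i = rowv (x *m a + y *m b + z *m c)].

(** The plane is spanned by the images of the eigenvector [w] under [a], [b], [c], and the points
    are its images under the matrices of the arc. They lie in the plane because coordinates in [K]
    act on [w] as scalars. *)
Lemma arc_arises_from_hyperoval : arises_from_hyperoval L O.
Proof.
have [w w0 eig] := field_space_eigenvector n_prime dimL fieldK.
have surj := trace_row_surj fieldK w0 eig.
have exP i : exists Q : 'M[F]_(N, 3 * N), O i = rowv Q /\
    exists x y z, [/\ x \in K, y \in K, z \in K & Q = x *m a + y *m b + z *m c].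
  have [x [y [z [xK yK zK e]]]] := coordO i.
  by exists (x *m a + y *m b + z *m c); split=> //; exists x, y, z.
have [P PE] := fin_all_exists exP.
pose xi := (<[w *m a^i]> + <[w *m b^i]> + <[w *m c^i]>)%VS.
pose x i := <[w *m (P i)^i]>%VS.
have memO (B : 'M[F]_(N, 3 * N)) v (W : {vspace 'rV[L]_(3 * N)}) : v \in rowv B ->
    w *m B^i \in W -> v^i \in conj_span W.
  case/rowvP => u -> wW; have [l ->] := surj u.
  by rewrite trace_row_mul trace_row_conj_span.
have xO i v : v \in O i -> v^i \in conj_span (x i).
  by rewrite (PE i).1 => vO; apply: (memO _ _ _ vO); rewrite memv_line.
have Ox i v : v^i \in conj_span (x i) -> v \in O i.
  apply: rational_mem (xO i); rewrite (arc_dim arcO).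
  rewrite (leq_trans (dim_conj_span _)) // dimL dim_vline.
  by case: (_ != 0); rewrite ?muln1 ?muln0.
have fullxi : conj_span xi = fullv.
  apply: rational_full => v.
  have : v \in (rowv a + rowv b + rowv c)%VS by rewrite full memvf.
  case/memv_addP => _ /memv_addP[v1 v1a [v2 v2b ->]] [v3 v3c ->].
  rewrite !map_mxD !rpredD //.
  - apply: (memO _ _ _ v1a); apply: (subvP (addvSl _ _)).
    by apply: (subvP (addvSl _ _)); rewrite memv_line.
  - apply: (memO _ _ _ v2b); apply: (subvP (addvSl _ _)).
    by apply: (subvP (addvSr _ _)); rewrite memv_line.
  - by apply: (memO _ _ _ v3c); apply: (subvP (addvSr _ _)); rewrite memv_line.
exists xi, x; split=> [|||i v]; last by split; [apply: xO | apply: Ox].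
- apply/eqP; rewrite eqn_leq; apply/andP; split.
    rewrite (leq_trans (dimv_add_leqif _ _).1) // dim_vline.
    rewrite (@leq_add _ _ 2 1) ?leq_b1 // (leq_trans (dimv_add_leqif _ _).1) //.
    by rewrite !dim_vline (@leq_add _ _ 1 1) ?leq_b1.
  (* N conjugates span 3N dimensions, so [xi] has dimension at least 3. *)
  have := dim_conj_span xi; rewrite fullxi dimv_rV dimL [leqLHS]mulnC leq_pmul2l //.
- exact: fullxi.
split=> [i j xij|i|i j l ij il jl [D [dD iD jD lD]]].
- case: arcO => injO _ _; apply: injO; apply/vspaceP => v.
  by apply/idP/idP => /xO; [rewrite xij | rewrite -xij] => /Ox.
- split.
    rewrite dim_vline; suff -> : w *m (P i)^i != 0 by [].
    have fP : row_free (P i) by apply: rowv_free; rewrite -(PE i).1 (arc_dim arcO).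
    apply: contra_neq w0 => e; apply: (row_free_inj (A := (P i)^i)).
      by rewrite row_free_map.
    by rewrite e mul0mx.
  rewrite -memvE; have [_ [u1 [u2 [u3 [u1K u2K u3K ->]]]]] := PE i.
  rewrite !map_mxD !map_mxM !mulmxDr !mulmxA.
  have [k1 ->] := eig _ u1K; have [k2 ->] := eig _ u2K; have [k3 ->] := eig _ u3K.
  by rewrite -!scalemxAl !memv_add ?rpredZ ?memv_line.
(* The conjugates of a line through three points would span all 3N dimensions, but they reach at
   most 2N. *)
have fullD : conj_span D = fullv.
  apply: rational_full => v; case: arcO => _ _ /(_ _ _ _ ij il jl) fO.
  have : v \in (O i + O j + O l)%VS by rewrite fO memvf.
  case/memv_addP => _ /memv_addP[v1 v1a [v2 v2b ->]] [v3 v3c ->].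
  rewrite !map_mxD !rpredD //.
  - exact: (subvP (conj_span_sub iD)) (xO _ _ v1a).
  - exact: (subvP (conj_span_sub jD)) (xO _ _ v2b).
  - exact: (subvP (conj_span_sub lD)) (xO _ _ v3c).
have := dim_conj_span D; rewrite fullD dimv_rV dimL dD [leqLHS]mulnC leq_pmul2l //.
Qed.

Lemma arc_regular_pseudo_hyperoval : is_regular_pseudo_hyperoval L O.
Proof.
exists O, \1%VF; split; first exact: arc_arises_from_hyperoval.
  by apply/eqP/lker0P => u v; rewrite !id_lfunE.
by move=> i; rewrite lim1g.
Qed.

End HyperovalOverField.

(** * Field actions and regular spreads *)

Section FieldAction.

Variables (F : finFieldType) (L : fieldExtType F) (V : vectType F).
Variables (U : {vspace V}) (rho : L -> 'End(V)).
(** Multiplicativity and scalars are asked on [U] only: [rho] will be the action on the quotient by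
    [O i], carried to a complement by projection. *)
Hypotheses (rhoD : forall l l' v, rho (l + l') v = rho l v + rho l' v)
  (rhoM : forall l l' v, v \in U -> rho (l * l') v = rho l (rho l' v))
  (rhoZ : forall (t : F) v, v \in U -> rho t%:A v = t *: v)
  (rhoU : forall l v, v \in U -> rho l v \in U).

Lemma action_scale (t : F) l v : v \in U -> rho (t *: l) v = t *: rho l v.
Proof. by move=> vU; rewrite -mulr_algl rhoM // rhoZ // rhoU. Qed.

Lemma action_nz l v : l != 0 -> v \in U -> v != 0 -> rho l v != 0.
Proof.
move=> l0 vU; apply: contra_neq => e.
by rewrite -[v]scale1r -rhoZ // scale1r -(mulVf l0) rhoM // e linear0.
Qed.

Definition action_orbit v : {vspace V} := limg (linfun (fun l => rho l v)).

Lemma action_orbit_spec v : v \in U -> v != 0 ->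
  \dim (action_orbit v) = \dim {:L} /\
  forall A : {vspace V}, (forall l, rho l v \in A) -> (action_orbit v <= A)%VS.
Proof.
move=> vU v0.
have lin : linear (fun l => rho l v) by move=> t l l'; rewrite rhoD action_scale.
pose f : {linear L -> V} := HB.pack (fun l => rho l v) (GRing.isLinear.Build F L V *:%R _ lin).
have -> : action_orbit v = limg (linfun f) by [].
split=> [|A h].
  rewrite limg_dim_eq // capfv; apply/eqP/lker0P => l l'; rewrite !lfunE /= => /eqP.
  rewrite -subr_eq0 -scaleN1r -action_scale // -rhoD scaleN1r => e.
  by apply/eqP; rewrite -subr_eq0; apply: contraTT e => ll'; apply: action_nz.
by apply/subvP => _ /memv_imgP[l _ ->]; rewrite lfunE /=.
Qed.

(* The transversal through [l a] and [l b] meets D in [l a + t_l (l b)]; additivity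
   of D forces [t_l] to be independent of [l]. *)
Lemma regulus_orbit n (R : seq {vspace V}) (A B C D : {vspace V}) :
    is_regulus n U R -> (U <= A + B)%VS ->
    A \in R -> B \in R -> C \in R -> D \in R -> A <> B -> A <> C -> B <> C ->
    (forall l v, v \in A -> rho l v \in A) -> (forall l v, v \in B -> rho l v \in B) ->
    (forall l v, v \in C -> rho l v \in C) -> (0 < n)%N ->
  exists d, [/\ d \in D, d != 0 & forall l, rho l d \in D].
Proof.
move=> [_ dimR disR transR] UAB AR BR CR DR AB AC BC stA stB stC n0.
have nz (X : {vspace V}) : X \in R -> exists2 v, v \in X & v != 0.
  by move=> /dimR[dX _]; apply: nz_vector => X0; rewrite -dX X0 dimv0 in n0.
have [->|DA] := eqVneq D A; first by have [v vA v0] := nz A AR; exists v; split=> // l; apply: stA.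
have [->|DB] := eqVneq D B; first by have [v vB v0] := nz B BR; exists v; split=> // l; apply: stB.
have subU (X : {vspace V}) v : X \in R -> v \in X -> v \in U by move=> /dimR[_ /subvP h]; apply: h.
have cap0 (X Y : {vspace V}) v : X \in R -> Y \in R -> X <> Y -> v \in X -> v \in Y -> v = 0.
  move=> XR YR XY vX vY; apply/eqP; rewrite -memv0 -(disR X Y XR YR XY) memv_cap.
  by rewrite vX vY.
have [c cC c0] := nz C CR.
have /memv_addP[a aA [b bB cE]] := subvP UAB _ (subU _ _ CR cC).
have a0 : a != 0.
  by apply: contra_neq c0 => a0; apply: (cap0 B C) => //; rewrite cE a0 add0r.
have b0 : b != 0.
  by apply: contra_neq c0 => b0; apply: (cap0 A C) => //; rewrite cE b0 addr0.
have aU := subU _ _ AR aA; have bU := subU _ _ BR bB.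
have trans (l : L) : l != 0 -> exists t : F, rho l a + t *: rho l b \in D.
  move=> l0; have la0 := action_nz l0 aU a0; have lb0 := action_nz l0 bU b0.
  pose ell := (<[rho l a]> + <[rho l b]>)%VS.
  have dell : \dim ell = 2%N.
    rewrite dimv_disjoint_sum ?dim_vline ?la0 ?lb0 //.
    apply/eqP; rewrite -subv0 -(disR A B AR BR AB).
    by apply: capvS; rewrite -memvE ?stA ?stB.
  have meet (X : {vspace V}) v : v \in X -> v \in ell -> v != 0 -> meets ell X.
    by move=> vX vl v0 e; case/eqP: v0; apply/eqP; rewrite -memv0 -e memv_cap vl vX.
  have lU : (ell <= U)%VS by rewrite subv_add -!memvE !rhoU.
  have [|||mD _] := transR ell A B C dell lU AR BR CR AB AC BC.
  - by apply: (meet _ (rho l a)); rewrite ?stA // (subvP (addvSl _ _)) ?memv_line.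
  - by apply: (meet _ (rho l b)); rewrite ?stB // (subvP (addvSr _ _)) ?memv_line.
  - apply: (meet _ (rho l c)); rewrite ?stC //; last by apply: action_nz => //; apply: subU CR _.
    by rewrite cE linearD memv_add ?memv_line.
  have [v + v0] := nz_vector (mD D DR); rewrite memv_cap => /andP[].
  case/memv_addP => _ /vlineP[s ->] [_ /vlineP[t ->] vE] vD.
  have s0 : s != 0.
    apply: contra_neq v0 => s0; apply: (cap0 D B) => //; first exact/eqP.
    by rewrite vE s0 scale0r add0r rpredZ // stB.
  exists (t / s); rewrite -[_ + _](scalerK s0) rpredZ // scalerDr scalerA.
  by rewrite mulrCA divff // mulr1 -vE.
have [t1 d1] := trans 1 (oner_neq0 _).
have rho1 v : v \in U -> rho 1 v = v by move=> vU; rewrite -[1]scale1r rhoZ // scale1r.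
rewrite !rho1 // in d1; exists (a + t1 *: b); split=> // [|l].
  apply: contra_neq a0 => e; apply: (cap0 A B) => //.
  by have /eqP := e; rewrite addr_eq0 => /eqP->; rewrite rpredN rpredZ.
have dU : a + t1 *: b \in U by rewrite rpredD // rpredZ.
(* Scalars preserve D; the comparison that follows needs l and 1 independent over F. *)
have [/vlineP[s ->]|l1] := boolP (l \in <[1]>%VS); first by rewrite rhoZ // rpredZ.
have l0 : l != 0 by apply: contraNneq l1 => ->; rewrite mem0v.
have l10 : l + 1 != 0.
  by apply: contraNneq l1 => /eqP; rewrite addr_eq0 => /eqP->; rewrite rpredN memv_line.
have [tl el] := trans l l0; have [t' e'] := trans _ l10.
(* The D-point over l + 1 minus those over l and 1 is this scalar applied to [b]; it lies in D and
   B, so it is zero. *)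
have key : (t' - tl) *: l + (t' - t1) *: 1 = 0.
  apply/eqP/negPn/negP => nz0.
  have := action_nz nz0 bU b0; case/negP; apply/eqP.
  apply: (cap0 D B) => //; [exact/eqP | | exact: stB].
  have -> : rho ((t' - tl) *: l + (t' - t1) *: 1) b =
      (rho (l + 1) a + t' *: rho (l + 1) b) - (rho l a + tl *: rho l b) - (a + t1 *: b).
    rewrite !rhoD !rho1 // !action_scale // rho1 // scalerDr !scalerBl.
    have id6 (p q x y z w : V) : x - z + (y - w) = p + q + (x + y) - (p + z) - (q + w).
      rewrite -[RHS]addrA -opprD [p + z + _]addrACA opprD [RHS]addrACA subrr add0r.
      by rewrite opprD [RHS]addrACA.
    exact: id6.
  by rewrite !rpredB.
have tE : t' = tl.
  apply/eqP; rewrite -subr_eq0; apply: contraNT l1 => tt.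
  have /eqP := key; rewrite addr_eq0 => /eqP e.
  by rewrite -[l](scalerK tt) e -scaleNr scalerA rpredZ // memv_line.
have t1E : t' = t1.
  by move: key; rewrite tE subrr scale0r add0r => /eqP; rewrite scaler_eq0 oner_eq0 orbF subr_eq0 -tE => /eqP.
by rewrite linearD linearZ /= -t1E tE.
Qed.

End FieldAction.

(** The counting contradiction for x = q^N: x^2 - 1 vectors do not fit among x^2 - 2. *)
Lemma mulSn_predn_gt (x : nat) : (1 < x -> ~~ (x.+1 * x.-1 <= (x * x).-1.-1))%N.
Proof. by case: x => [|[|x]] // _; rewrite -ltnNge; lia. Qed.

(** * The projections as spreads, and their regularity under a field action *)

Section DeltaSpread.

Variables (F : finFieldType) (n : nat).
Local Notation N := n.+1.
Local Notation k := (#|F| ^ N + 2)%N.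
Variable O : 'I_k -> {vspace 'rV[F]_(3 * N)}.
Hypothesis arcO : is_generalized_arc O.
Variables (i : 'I_k) (U : {vspace 'rV[F]_(3 * N)}).
Hypotheses (dimU : \dim U = (2 * N)%N) (capU : (U :&: O i)%VS = 0%VS).

Let D j := ((O i + O j) :&: U)%VS.

Lemma arc_third j : exists l, l != i /\ l != j.
Proof.
have : (0 < #|~: [set i; j]|)%N.
  rewrite cardsCs setCK card_ord subn_gt0 (leq_ltn_trans (_ : _ <= 2)%N) //.
    by rewrite cards2; case: (_ != _).
  by rewrite addn2 !ltnS expn_gt0 (ltnW (finRing_gt1 F)).
by case/card_gt0P => l; rewrite !inE negb_or => /andP[? ?]; exists l.
Qed.

Lemma arc_dim2 j : j != i -> \dim (O i + O j) = (2 * N)%N.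
Proof.
move=> ji; have [l [li lj]] := arc_third j.
have jl : j != l by rewrite eq_sym.
have := (dimv_add_leqif (O i + O j)%VS (O l)).1.
have := (dimv_add_leqif (O i) (O j)).1.
rewrite (arc_full arcO ji li jl) dimv_rV !(arc_dim arcO).
by move: (\dim _) => d; lia.
Qed.

Lemma dim_Delta j : j != i -> \dim (D j) = N.
Proof.
move=> ji; have := dimv_sum_cap (O i + O j)%VS U.
have -> : (O i + O j + U)%VS = fullv.
  by rewrite -addvA [(O j + U)%VS]addvC addvA (arc_add_compl arcO dimU capU) sumfv.
rewrite dimv_rV (arc_dim2 ji) dimU -/(D j); move: (\dim _) => d; lia.
Qed.

(** The spans with [O i] meet exactly in [O i] by dimension, and [U] avoids [O i]. *)
Lemma Delta_disjoint j l : j != i -> l != i -> j != l -> (D j :&: D l)%VS = 0%VS.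
Proof.
move=> ji li jl.
have capO : ((O i + O j) :&: (O i + O l))%VS = O i.
  apply/esym/eqP; rewrite eqEdim subv_cap !addvSl (arc_dim arcO) /=.
  have := dimv_sum_cap (O i + O j)%VS (O i + O l)%VS.
  have -> : (O i + O j + (O i + O l))%VS = fullv.
    by rewrite addvA -[(O i + O j + O i)%VS]addvA [(O j + O i)%VS]addvC addvA addvv (arc_full arcO).
  rewrite dimv_rV !arc_dim2 //; move: (\dim _) => d; lia.
apply/eqP; rewrite -subv0 -capU -capO subv_cap; apply/andP; split.
  exact: subv_trans (capvSl _ _) (capvSr _ _).
by apply: capvS; apply: capvSl.
Qed.

(** The q^N + 1 disjoint members have as many nonzero vectors in total as [U], so no vector can be
    missed. *)
Lemma Delta_cover v : v \in U -> v != 0 -> exists2 j, j != i & v \in D j.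
Proof.
move=> vU v0; have [/exists_inP//|none] := boolP [exists (j | j != i), v \in D j].
exfalso.
have q1 : (1 < #|F| ^ N)%N by rewrite -{1}(expn0 #|F|) ltn_exp2l // finRing_gt1.
pose X : {set 'rV[F]_(3 * N)} := [set u in U | u != 0].
have cnz (W : {vspace 'rV[F]_(3 * N)}) : #|[set u in W | u != 0]| = (#|F| ^ \dim W).-1.
  have := card_vspace W => <-; rewrite (cardD1 0 W) mem0v /=; apply: eq_card => u.
  by rewrite !inE andbC.
have le1 u : u != 0 -> (\sum_(j | j != i) (u \in D j) <= 1)%N.
  move=> u0; have [/existsP[j /andP[ji uj]]|/existsPn h] :=
      boolP [exists j, (j != i) && (u \in D j)].
    rewrite (bigD1 j) //= uj big1 // => l /andP[li lj]; apply/eqP; rewrite eqb0.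
    apply: contraNN u0 => ul; rewrite -memv0 -(@Delta_disjoint j l) //.
      by rewrite memv_cap uj ul.
    by rewrite eq_sym.
  rewrite big1 // => j ji; apply/eqP; rewrite eqb0.
  by have := h j; rewrite ji.
have total : (\sum_(u in X) \sum_(j | j != i) (u \in D j) =
    (#|F| ^ N).+1 * (#|F| ^ N).-1)%N.
  rewrite exchange_big /= (eq_bigr (fun=> (#|F| ^ N).-1)) => [|j ji].
    rewrite sum_nat_const; congr (_ * _)%N.
    rewrite (@eq_card _ _ (mem (~: [set i]))) => [|j]; last by rewrite !inE.
    by rewrite cardsC1 card_ord addn2.
  have := cnz (D j); rewrite dim_Delta // => <-.
  rewrite -sum1_card big_mkcond [RHS]big_mkcond /=.
  apply: eq_bigr => u _; rewrite !inE memv_cap.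
  by case: (u \in U); case: (u \in _); case: (u != 0).
have vX : v \in X by rewrite inE vU.
have : (\sum_(u in X) \sum_(j | j != i) (u \in D j) <= #|X|.-1)%N.
  rewrite (bigD1 v) //= [X in (X + _)%N]big1 => [|j ji]; last first.
    apply/eqP; rewrite eqb0; apply: contraNN none => vj.
    by apply/exists_inP; exists j.
  rewrite add0n; apply: (@leq_trans (\sum_(u in X | u != v) 1)%N).
    by apply: leq_sum => u /andP[]; rewrite inE => /andP[_ u0] _; apply: le1.
  have -> : #|X|.-1 = #|[predD1 X & v]| by rewrite (cardD1 v X) vX.
  by rewrite sum1_card; apply/eq_leq/eq_card => u; rewrite !inE unfold_in /= inE andbC.
rewrite total /X cnz dimU mul2n -addnn expnD.
exact/negP/mulSn_predn_gt.
Qed.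

Lemma Delta_spread : is_spread N U (Delta O i U).
Proof.
split=> [A /DeltaP[j ji ->]|P /dim1_line[v v0 ->]].
  by rewrite dim_Delta // capvSr.
rewrite -memvE => vU; have [j ji vj] := Delta_cover vU v0.
exists (D j); split; first by rewrite mem_Delta // -memvE.
move=> A [/DeltaP[l li ->]]; rewrite -memvE => vl.
have [->//|jl] := eqVneq j l; case/eqP: v0; apply/eqP.
by rewrite -memv0 -(Delta_disjoint ji li jl) memv_cap vj.
Qed.

Section Action.

Variables (L : fieldExtType F) (act : L -> 'End('rV[F]_(3 * N))).
Hypothesis dimL : \dim {:L} = N.
Hypotheses (actD : forall l l' v, act (l + l') v = act l v + act l' v)
  (actM : forall l l' v, act (l * l') v = act l (act l' v))
  (actZ : forall (t : F) v, act t%:A v = t *: v)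
  (actO : forall j l v, v \in O j -> act l v \in O j).

(** The action projects to [U] and preserves the spread members. A regulus element through three of
    them contains a full L-orbit, hence equals it by dimension, and so does the member through the
    same vector. *)
Lemma Delta_regular : is_regular_spread N U (Delta O i U).
Proof.
have spread := Delta_spread; split=> // A B C AD BD CD AB AC BC R regR AR BR CR E ER.
pose p := daddv_pi U (O i).
pose rho l := (p \o act l)%VF.
have full := arc_add_compl arcO dimU capU.
have pU v : p v \in U by apply: memv_pi.
have pid v : v \in U -> p v = v := daddv_pi_id capU.
have pO v : p v - v \in O i.
  have : v \in (U + O i)%VS by rewrite addvC full memvf.
  by move/(daddv_pi_add capU) => e; rewrite -{2}e -/p opprD addrA subrr sub0r rpredN memv_pi.
have pker v : v \in O i -> p v = 0.
  move=> vO; apply/eqP; rewrite -memv0 -capU memv_cap pU /=.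
  by rewrite -[p v](subrK v) rpredD ?pO.
have rhoD l l' v : rho (l + l') v = rho l v + rho l' v.
  by rewrite !comp_lfunE actD linearD.
have rhoM l l' v : v \in U -> rho (l * l') v = rho l (rho l' v).
  move=> _; rewrite !comp_lfunE actM; apply/eqP; rewrite -subr_eq0.
  have -> x : p (act l x) - p (act l (p x)) = p (act l (x - p x)) by rewrite !linearB.
  by rewrite pker // actO // -opprB rpredN.
have rhoZ (t : F) v : v \in U -> rho t%:A v = t *: v.
  by move=> vU; rewrite comp_lfunE actZ linearZ /= pid.
have rhoU l v : v \in U -> rho l v \in U by move=> _; rewrite comp_lfunE.
have stD j l v : v \in D j -> rho l v \in D j.
  rewrite !memv_cap => /andP[vOj vU]; rewrite rhoU // andbT comp_lfunE.
  rewrite -[p _](subrK (act l v)) rpredD ?(subvP (addvSl _ _) _ (pO _)) //.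
  case/memv_addP: vOj => v1 v1O [v2 v2O ->].
  by rewrite linearD memv_add ?actO.
have stA l X v : X \in Delta O i U -> v \in X -> rho l v \in X.
  by case/DeltaP => j _ ->; apply: stD.
have UAB : (U <= A + B)%VS.
  have [dA sA] := spread.1 A AD; have [dB sB] := spread.1 B BD.
  have dAB : (A :&: B)%VS = 0%VS by case: regR => _ _ dis _; apply: dis.
  have /eqP <- // : (A + B == U)%VS.
  rewrite eqEdim subv_add sA sB dimv_disjoint_sum // dA dB dimU; lia.
have [d [dE d0 stE]] := regulus_orbit rhoD rhoM rhoZ rhoU regR UAB AR BR CR ER AB AC BC
  (fun l v => stA l A v AD) (fun l v => stA l B v BD) (fun l v => stA l C v CD) (ltn0Sn n).
have [dimE subE] : \dim E = N /\ (E <= U)%VS by case: regR => _ h _ _; apply: h.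
have dU := subvP subE _ dE; have [j ji dj] := Delta_cover dU d0.
have [dorb sub] := action_orbit_spec rhoD rhoM rhoZ rhoU dU d0.
have orbE : action_orbit rho d = E.
  by apply/eqP; rewrite eqEdim sub // dorb dimL dimE /=.
have orbD : action_orbit rho d = D j.
  apply/eqP; rewrite eqEdim sub => [|l]; last exact: stD.
  by rewrite dorb dimL dim_Delta /=.
by rewrite -orbE orbD mem_Delta.
Qed.

End Action.
End DeltaSpread.

(** * The field action on a regular pseudo-hyperoval *)

Section HyperovalAction.

Variables (F : finFieldType) (L : splittingFieldType F) (n : nat).
Local Notation N := n.+1.
Local Notation k := (#|F| ^ N + 2)%N.
Local Notation G := 'Gal({:L} / 1)%g.
Local Notation "A ^i" := (map_mx (in_alg L) A) (at level 2, format "A ^i").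
Hypothesis dimL : \dim {:L} = N.
Variable O : 'I_k -> {vspace 'rV[F]_(3 * N)}.
Hypothesis dimO : forall i, \dim (O i) = N.

(** The N conjugates of the plane fill 3N dimensions, so their sum is direct and the term of the
    identity vanishes. *)
Lemma conj_sum_inj (xi : {vspace 'rV[L]_(3 * N)}) w :
    \dim xi = 3%N -> conj_span xi = fullv -> w \in xi ->
  \sum_(s in G) map_mx s w = 0 -> w = 0.
Proof.
move=> dxi full wxi e.
have dir : directv (\sum_(s in G) conj_space s xi).
  rewrite directvEgeq /= -/(conj_span xi) full dimv_rV.
  rewrite (leq_trans (n := (\sum_(s in G) 3)%N)) //.
    by apply: leq_sum => s _; rewrite -[leqRHS]dxi dim_conj_space.
  by rewrite sum_nat_const card_galois_full dimL mulnC.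
have G1 : (1 : gal_of {:L})%g \in G by apply: group1.
have /directv_sum_independent ind := dir.
have e1 := ind (fun s => map_mx s w) (fun s _ => mem_conj_space s wxi) e 1%g G1.
by apply/rowP => j; have /rowP/(_ j) := e1; rewrite !mxE gal_id.
Qed.

(** Taking traces identifies the plane, as L^3, with F^(3N), and scalar multiplication is
    transported; each [O i] is the image of an L-line. *)
Lemma hyperoval_action : is_regular_pseudo_hyperoval L O ->
  exists act : L -> 'End('rV[F]_(3 * N)),
    [/\ forall l l' v, act (l + l') v = act l v + act l' v,
        forall l l' v, act (l * l') v = act l (act l' v),
        forall (t : F) v, act t%:A v = t *: v
      & forall i l v, v \in O i -> act l v \in O i].
Proof.
case=> pi [g [[xi [x [dxi full hyp piE]]] kg OE]].
have /lker0P g_inj : lker g == 0%VS by rewrite kg.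
have basisE d : \dim xi = d -> exists e : d.-tuple 'rV[L]_(3 * N), basis_of xi e.
  by move=> <-; exists (vbasis xi); apply: vbasisP.
have [e eb] := basisE _ dxi; have fe := basis_free eb.
pose comb (u : {ffun 'I_3 -> L}) := \sum_h u h *: e`_h.
pose sc l (u : {ffun 'I_3 -> L}) := [ffun h => l * u h].
have comb_xi u : comb u \in xi.
  rewrite rpred_sum // => h _; rewrite rpredZ // (basis_mem eb) // mem_nth //.
  by rewrite size_tuple.
have combZ l u : comb (sc l u) = l *: comb u.
  by rewrite scaler_sumr; apply: eq_bigr => h _; rewrite ffunE scalerA.
pose Tf u := g (trace_row (comb u) 1).
have traceD (w w' : 'rV[L]_(3 * N)) : trace_row (w + w') 1 = trace_row w 1 + trace_row w' 1.
  by apply/rowP => j; rewrite !mxE mulrDr linearD.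
have linT : linear Tf.
  move=> t u u'; rewrite /Tf -linearZ -linearD /=; congr (g _).
  have -> : comb (t *: u + u') = t%:A *: comb u + comb u'.
    rewrite -combZ /comb -big_split; apply: eq_bigr => h _ /=.
    by rewrite !ffunE mulr_algl scalerDl.
  by rewrite traceD trace_row_scale mul1r -linearZ.
pose T : 'Hom({ffun 'I_3 -> L}, 'rV[F]_(3 * N)) :=
  linfun (HB.pack Tf (GRing.isLinear.Build F _ _ *:%R _ linT) : {linear _ -> _}).
have TE u : T u = Tf u by rewrite lfunE.
have T0 u : T u = 0 -> u = 0.
  rewrite TE /Tf -(linear0 g) => /g_inj /(congr1 (map_mx (in_alg L))).
  rewrite map_mx0 map_trace_row scale1r => /(conj_sum_inj dxi full (comb_xi u)) c0.
  apply/ffunP => h; rewrite ffunE.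
  by have /freeP := fe; apply.
have kT : lker T == 0%VS.
  apply/lker0P => u u' /eqP; rewrite -subr_eq0 -linearB => /eqP/T0/eqP.
  by rewrite subr_eq0 => /eqP.
have imT v : v \in limg T.
  suff -> : limg T = fullv by rewrite memvf.
  apply/eqP; rewrite eqEdim subvf limg_dim_eq ?capfv ?(eqP kT) //.
  rewrite dimv_rV dimvf /= -dimL dimvf.
  have -> : dim {ffun 'I_3 -> L} = (#|'I_3| * dim L)%N by reflexivity.
  by rewrite card_ord.
have onto v : exists u, v = T u by exists (T^-1%VF v); rewrite limg_lfunVK.
have linS l : linear (sc l).
  by move=> t u u'; apply/ffunP => h; rewrite !ffunE mulrDr scalerAr.
pose S l : 'End({ffun 'I_3 -> L}) :=
  linfun (HB.pack (sc l) (GRing.isLinear.Build F _ _ *:%R _ (linS l)) : {linear _ -> _}).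
pose act l := (T \o S l \o T^-1)%VF.
have actE l u : act l (T u) = T (sc l u).
  by rewrite !comp_lfunE lker0_lfunK //; congr (T _); rewrite lfunE.
exists act; split.
- move=> l l' v; have [u ->] := onto v; rewrite !actE -linearD /=; congr (T _).
  by apply/ffunP => h; rewrite !ffunE mulrDl.
- move=> l l' v; have [u ->] := onto v; rewrite !actE; congr (T _).
  by apply/ffunP => h; rewrite !ffunE mulrA.
- move=> t v; have [u ->] := onto v; rewrite !actE -linearZ /=; congr (T _).
  by apply/ffunP => h; rewrite !ffunE mulr_algl.
move=> i l v; case: hyp => _ /(_ i)[/dim1_line[w w0 xE] wxi] _.
have {}wxi : w \in xi by rewrite memvE -xE.
pose c := [ffun h => coord e h w].
have cE : comb c = w.
  rewrite [RHS](coord_basis eb wxi); apply: eq_bigr => h _; by rewrite ffunE.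
(* [H] parametrises [O i] by L: the traces of l w lie there, and the dimensions agree. *)
pose H := (g \o linfun (trace_row w))%VF.
have HE l' : H l' = T (sc l' c).
  rewrite comp_lfunE lfunE TE /Tf combZ cE; congr (g _) => /=.
  by rewrite trace_row_scale mul1r.
have kH : lker H == 0%VS.
  apply/lker0P => l1 l2 /eqP; rewrite -subr_eq0 -linearB /= HE => /eqP/T0/(congr1 comb).
  rewrite combZ cE {1}/comb big1 => [|h _]; last by rewrite ffunE scale0r.
  by move/eqP; rewrite scaler_eq0 (negPf w0) orbF subr_eq0 => /eqP.
have HO : limg H = O i.
  apply/eqP; rewrite eqEdim dimO limg_dim_eq ?capfv ?(eqP kH) // dimL leqnn andbT.
  apply/subvP => _ /memv_imgP[l' _ ->]; rewrite comp_lfunE lfunE OE memv_img //=.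
  by apply/piE; rewrite trace_row_conj_span // xE memv_line.
rewrite -HO => /memv_imgP[l' _ ->]; apply/memv_imgP; exists (l * l'); rewrite ?memvf //.
by rewrite !HE actE; congr (T _); apply/ffunP => h; rewrite !ffunE mulrA.
Qed.

End HyperovalAction.

Local Close Scope ring_scope.

Theorem theorem6p3 (h n : nat) (F : finFieldType) (L : splittingFieldType F)
    (hh : 1 < h) (hF : #|F| = 2 ^ h) (hn : prime n) (hL : \dim {:L} = n)
    (O : 'I_(#|F| ^ n + 2) -> {vspace 'rV[F]_(3 * n)})
    (hO : is_pseudo_hyperoval O)
    (U : 'I_(#|F| ^ n + 2) -> {vspace 'rV[F]_(3 * n)})
    (hU : forall i, \dim (U i) = 2 * n /\ (U i :&: O i)%VS = 0%VS) :
  is_regular_pseudo_hyperoval L O <->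
  exists I : {set 'I_(#|F| ^ n + 2)},
    #|F| ^ n - 1 <= #|I| /\
    forall i, i \in I -> is_regular_spread n (U i) (Delta O i (U i)).
Proof.
case: n hn hL O hO U hU => [//|n] n_prime dimL O arcO U hU; split=> [regO|[I [cardI regI]]].
  have [act [actD actM actZ actO]] := hyperoval_action dimL (arc_dim arcO) regO.
  (* All the spreads are regular, so every index can be taken. *)
  exists setT; split; first by rewrite cardsT card_ord leq_subLR add1n addn2 ltnW // ltnW.
  by move=> i _; have [dU cU] := hU i; apply: (Delta_regular arcO dU cU dimL actD).
(* h > 1 gives q >= 4, more than the at most three irregular elements. *)
have q_gt3 : 3 < #|F| by rewrite hF (leq_trans (_ : 4 <= 2 ^ 2)) // leq_exp2l.
have [a [b [c [K [full fieldK coordO]]]]] := arc_over_field n_prime q_gt3 arcO hU cardI regI.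
exact: (arc_regular_pseudo_hyperoval n_prime dimL arcO fieldK full coordO).
Qed.
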